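(* If $n$ is a product of $2$, $3$, or $4$ pairwise distinct primes, then the $n\times n$ square has no perfect Mondrian partition.
   Context: A Mondrian partition of an $n\times n$ square ($n$ a positive integer) is a dissection of the square into $k\ge 2$ non-overlapping rectangles with positive integer side lengths which are pairwise non-congruent (rectangles of dimensions $a\times b$ and $b\times a$ count as congruent). It is perfect if all its rectangles have the same area. *)

(* Defs.v *)
From mathcomp Require Import all_boot.
Unset Printing Implicit Defensive.

(* A family of k axis-parallel rectangles inside the n x n square [0,n]^2.
   Rectangle i has lower-left corner (x i, y i) and width w i, height h i
   (all natural numbers; integer coordinates are WLOG). *)

(* Rectangle i covers the unit cell [a,a+1] x [b,b+1]. *)
Definition covers (k : nat) (x y w h : 'I_k -> nat) (i : 'I_k) (a b : nat) : Prop :=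
  x i <= a < x i + w i /\ y i <= b < y i + h i.

Definition congruent (k : nat) (w h : 'I_k -> nat) (i j : 'I_k) : Prop :=
  (w i = w j /\ h i = h j) \/ (w i = h j /\ h i = w j).

Definition mondrian_partition (n k : nat) (x y w h : 'I_k -> nat) : Prop :=
  [/\ 2 <= k,
      (forall i, [/\ 0 < w i, 0 < h i, x i + w i <= n & y i + h i <= n]),
      (forall a b, a < n -> b < n -> exists i, covers k x y w h i a b),
      (forall i j a b, covers k x y w h i a b -> covers k x y w h j a b -> i = j)
    &
      (forall i j, i != j -> ~ congruent k w h i j)].

Definition perfect_mondrian_partition (n k : nat) (x y w h : 'I_k -> nat) : Prop :=
  mondrian_partition n k x y w h /\ (forall i j, w i * h i = w j * h j).

Definition prod_distinct_primes (m n : nat) : Prop :=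
  exists s : seq nat, [/\ uniq s, all prime s, size s = m & n = \prod_(p <- s) p].

(* Main.v *)
Require Import Defs.
From Stdlib Require Import NArith.
From mathcomp Require Import all_boot.
From mathcomp Require Import zify.

(* From a perfect partition into k rectangles of area A = n^2/k, only the
   following is kept: every rectangle lies in a row of rectangles whose widths
   add up to n and in a column of rectangles whose heights add up to n, and
   every row meets every column in exactly one rectangle.  This is invariant
   under scaling, so n may be taken to be a product of four distinct primes.

   The 2k side lengths are divisors of A, essentially distinct, so
   2k <= d(A) + 1; this leaves k = p, k = p^2 or k = p p' with primes
   p, p' dividing n.  All sides are at least n/k and, unless equal to n, at most
   n - n/k.  Writing one side of each rectangle as (n/k) u, with u a product of
   the remaining primes to the powers -1, 0, 1, these bounds leave fewer than k
   values of u, except for k = 3 and k = 4 (excluded by looking at one row), for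
   an infinite family with k = 5 (excluded by divisibility of the row sum by one
   of the primes), and for finitely many n.  The latter are excluded by an
   exhaustive search for orientations of the candidate rectangles that admit
   rows and columns as above. *)

(** * Rows and columns of a perfect partition *)

Set Implicit Arguments.
Unset Strict Implicit.

(** Coordinates are forgotten, so that the structure survives scaling and transposition; the area
    equation carries the factor [k] to avoid a division. *)
Record grid (n k : nat) (w h : 'I_k -> nat) (row col : 'I_k -> {set 'I_k}) : Prop := Grid {
  grid_k : 1 < k;
  grid_w : forall i, 0 < w i;
  grid_h : forall i, 0 < h i;
  grid_rowi : forall i, i \in row i;
  grid_coli : forall i, i \in col i;
  grid_row : forall i, \sum_(j in row i) w j = n;
  grid_col : forall i, \sum_(j in col i) h j = n;
  grid_cross : forall i j, #|row i :&: col j| = 1;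
  grid_area : forall i, k * (w i * h i) = n ^ 2;
  grid_ncong : forall i j, i != j -> ~ congruent k w h i j }.

Lemma sum_indicator_segment m c d : c + d <= m -> \sum_(a < m) (c <= a < c + d) = d.
Proof.
move=> cdm; rewrite -(big_mkord xpredT (fun a => (c <= a < c + d) : nat)).
rewrite (@big_cat_nat _ _ _ c) //=; last by lia.
rewrite [X in _ + X](@big_cat_nat _ _ _ (c + d)) //=; last by lia.
rewrite big_nat_cond big1 ?add0n; last by move=> i; lia.
rewrite [X in _ + X]big_nat_cond [X in _ + X]big1 ?addn0; last by move=> i; lia.
rewrite (eq_big_nat _ _ (F2 := fun=> 1)); last by move=> i; lia.
by rewrite sum_nat_const_nat; lia.
Qed.

Section Geometry.

Variables (n k : nat) (x y w h : 'I_k -> nat).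
Hypothesis inside : forall i, x i + w i <= n.
Hypothesis cover : forall a b, a < n -> b < n -> exists i, covers k x y w h i a b.
Hypothesis disjoint : forall i j a b,
  covers k x y w h i a b -> covers k x y w h j a b -> i = j.

(** Double counting in the strip of unit cells at height [b]: each of its [n] cells lies in exactly
    one rectangle. With the two axes exchanged this also gives the column sums. *)
Lemma row_width_sum b : b < n -> \sum_(j | y j <= b < y j + h j) w j = n.
Proof.
move=> bn; rewrite big_mkcond /=.
transitivity (\sum_(j < k) \sum_(a < n) ((y j <= b < y j + h j) && (x j <= a < x j + w j))).
  apply: eq_bigr => j _; case: ifP => [_|_] /=; last by rewrite big1.
  by rewrite sum_indicator_segment.
rewrite exchange_big /= -[RHS]card_ord -sum1_card; apply: eq_bigr => a _.
have [i [ha hb]] := cover (ltn_ord a) bn.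
rewrite (bigD1 i) //= ha hb /= big1 // => j; apply: contraNeq.
rewrite eqb0 negbK => /andP[hb' ha'].
by apply/eqP/(disjoint (a := a) (b := b)).
Qed.

End Geometry.

Lemma grid_of_partition n k x y w h :
  perfect_mondrian_partition n k x y w h -> exists row col, grid n w h row col.
Proof.
case=> -[k2 ins cov dis ncong] area.
(* The row of [i] is read off along the strip of cells just above its bottom edge, the column along
   the strip next to its left edge. *)
exists (fun i => [set j | y j <= y i < y j + h j]).
exists (fun i => [set j | x j <= x i < x j + w j]).
have rowP b : b < n -> \sum_(j | y j <= b < y j + h j) w j = n.
  by apply: (@row_width_sum n k x y w h) => // i; case: (ins i).
have colP b : b < n -> \sum_(j | x j <= b < x j + w j) h j = n.
  apply: (@row_width_sum n k y x h w) => [i|a c an cn|i j a c [? ?] [? ?]].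
  - by case: (ins i).
  - by have [i []] := cov c a cn an; exists i.
  - exact: (dis i j c a).
have xn i : x i < n by case: (ins i); lia.
have yn i : y i < n by case: (ins i); lia.
split=> // [i|i|i|i|i|i|i j|i].
- by case: (ins i).
- by case: (ins i).
- by rewrite inE; case: (ins i); lia.
- by rewrite inE; case: (ins i); lia.
- by rewrite -[RHS](rowP _ (yn i)); apply: eq_bigl => j; rewrite inE.
- by rewrite -[RHS](colP _ (xn i)); apply: eq_bigl => j; rewrite inE.
(* The common rectangle is the one covering the cell with corner [(x j, y i)]. *)
- have [l [hx hy]] := cov _ _ (xn j) (yn i).
  apply/eqP/cards1P; exists l; apply/setP => m; rewrite !inE.
  apply/andP/eqP => [[hy' hx']|->] //.
  by apply: (dis m l (x j) (y i)).
- have -> : k * (w i * h i) = \sum_(j < k) w j * h j.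
    by rewrite (eq_bigr (fun=> w i * h i)) ?sum_nat_const ?card_ord.
  (* The total area is counted strip by strip. *)
  transitivity (\sum_(b < n) \sum_(j | y j <= b < y j + h j) w j); last first.
    by rewrite (eq_bigr (fun=> n)) ?sum_nat_const ?card_ord ?mulnn // => b _; apply: rowP.
  under [RHS]eq_bigr do rewrite big_mkcond /=.
  rewrite exchange_big /=; apply: eq_bigr => j _.
  rewrite mulnC -{1}(@sum_indicator_segment n (y j) (h j)); last by case: (ins j).
  by rewrite big_distrl /=; apply: eq_bigr => b _; case: ifP => _; rewrite ?mul1n.
Qed.

(** * Symmetries of grids and bounds on their sides *)

Section Grid.

Variables (n k : nat).
Implicit Types (w h : 'I_k -> nat) (row col : 'I_k -> {set 'I_k}).

Lemma grid_transpose w h row col : grid n w h row col -> grid n h w col row.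
Proof.
case=> k2 w0 h0 ri ci r c cr a nc; split=> // [i j|i|i j ij [[? ?]|[? ?]]].
- by rewrite setIC.
- by rewrite [h i * _]mulnC.
- by apply: (nc i j ij); left.
- by apply: (nc i j ij); right.
Qed.

Lemma grid_scale c w h row col :
  0 < c -> grid n w h row col ->
  grid (c * n) (fun i => c * w i) (fun i => c * h i) row col.
Proof.
move=> c0 [k2 w0 h0 ri ci r cl cr a nc]; split=> // [i|i|i|i|i|i j ij].
- by rewrite muln_gt0 c0 w0.
- by rewrite muln_gt0 c0 h0.
- by rewrite -big_distrr /= r.
- by rewrite -big_distrr /= cl.
- by rewrite expnMn -(a i); lia.
- move=> cong; apply: (nc i j ij); case: cong => -[/eqP e1 /eqP e2].
  + by left; move: e1 e2; rewrite !eqn_pmul2l // => /eqP ? /eqP.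
  + by right; move: e1 e2; rewrite !eqn_pmul2l // => /eqP ? /eqP.
Qed.

Variables (w h : 'I_k -> nat) (row col : 'I_k -> {set 'I_k}).
Hypothesis G : grid n w h row col.

Lemma grid_n_gt0 (i : 'I_k) : 0 < n.
Proof.
have := grid_area G i; have := grid_k G; have := grid_w G i; have := grid_h G i.
by rewrite lt0n; case: (eqVneq n 0) => [->|] //; nia.
Qed.

Lemma grid_width_le i : w i <= n.
Proof. by rewrite -(grid_row G i) (bigD1 i) ?(grid_rowi G) //= leq_addr. Qed.

Lemma grid_area_eq i j : w i * h i = w j * h j.
Proof.
apply/eqP; rewrite -(@eqn_pmul2l k) ?(ltnW (grid_k G)) //.
by rewrite !(grid_area G).
Qed.

(** Since areas agree, one shared side already makes two rectangles congruent. *)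
Lemma grid_inj i j : w i = w j \/ w i = h j -> i = j.
Proof.
move=> wij; apply/eqP; apply: contraT => ij; case: (grid_ncong G ij).
have /eqP A := grid_area_eq i j; case: wij => E; [left|right]; split=> //; apply/eqP.
  by move: A; rewrite E eqn_pmul2l ?(grid_w G).
by move: A; rewrite E [w j * _]mulnC eqn_pmul2l ?(grid_h G).
Qed.

End Grid.

(** This turns a list of possible lengths for one side of each rectangle into an upper bound for
    [k]. *)
Lemma grid_choose_side_inj n k (w h e : 'I_k -> nat) row col :
  grid n w h row col -> (forall i, e i = w i \/ e i = h i) -> injective e.
Proof.
move=> G ewh i j; have G' := grid_transpose G.
case: (ewh i) (ewh j) => -> [] -> E.
- by apply: (grid_inj G); left.
- by apply: (grid_inj G); right.
- by apply: (grid_inj G'); right.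
- by apply: (grid_inj G'); left.
Qed.

Section GridBounds.

Variables (n k : nat) (w h : 'I_k -> nat) (row col : 'I_k -> {set 'I_k}).
Hypothesis G : grid n w h row col.

(** The area is n^2 / k and the height is at most n. *)
Lemma grid_width_ge i : n <= k * w i.
Proof.
have hn := grid_width_le (grid_transpose G) i.
rewrite -(@leq_pmul2r n) ?(grid_n_gt0 G i) // mulnn -(grid_area G i) mulnA.
by rewrite leq_mul2l hn orbT.
Qed.

Lemma grid_neighbour i : w i != n -> exists2 j, j \in row i & (i != j) && (w i + w j <= n).
Proof.
move=> wn; have := grid_row G i; rewrite (bigD1 i) ?(grid_rowi G) //=.
case: (pickP [pred j | (j \in row i) && (j != i)]) => [j /andP[jr ji]|none]; last first.
  by rewrite big_pred0 ?addn0 // => E; rewrite E eqxx in wn.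
rewrite (bigD1 j) ?jr //= => E; exists j => //; rewrite eq_sym ji /=; lia.
Qed.

(* The remaining width of a row must accommodate another rectangle, which is at least n/k wide. *)
Lemma grid_width_gap i : w i = n \/ k * w i <= k.-1 * n.
Proof.
case: (eqVneq (w i) n) => [|wn]; [by left | right].
have [j _ /andP[_ wij]] := grid_neighbour wn.
have := grid_width_ge j; have := grid_k G; nia.
Qed.

End GridBounds.

(** * An exhaustive search for orientations *)

Definition transpose (c : N * N) : N * N := (c.2, c.1).

(** Subset sum with alternatives, because an undecided rectangle may enter with either side or not
    at all. The test [N.leb d t] guards the truncated subtraction. *)
Fixpoint subsum (t : N) (opts : seq (seq N)) : bool :=
  if N.eqb t 0 then true else
  if opts is o :: os then
    if has (fun d => if N.leb d t then subsum (N.sub t d) os else false) o then true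
    else subsum t os
  else false.

Fixpoint exact_sums (f : N * N -> N) (t : N) (l : seq (N * N)) : seq (seq (N * N)) :=
  if l is x :: l' then
    (if N.leb (f x) t then map (cons x) (exact_sums f (N.sub t (f x)) l') else [::])
      ++ exact_sums f t l'
  else if N.eqb t 0 then [:: [::]] else [::].

(** A necessary condition only: the row and the column through [x] are tested independently, and an
    undecided rectangle may be turned differently in the two tests. *)
Definition completable (n : N) (placed todo : seq (N * N)) (x : N * N) : bool :=
  let others := rem x placed in
  let free := [seq [:: c.1; c.2] | c <- todo] in
  if subsum (N.sub n x.1) ([seq [:: y.1] | y <- others] ++ free)
  then subsum (N.sub n x.2) ([seq [:: y.2] | y <- others] ++ free)
  else false.

(** Again only necessary: the row and the column are chosen anew for each pair, not as one system
    for all pairs. *)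
Definition crossing (n : N) (l : seq (N * N)) : bool :=
  let rows := exact_sums fst n l in
  let cols := exact_sums snd n l in
  all (fun x => all (fun y =>
    has (fun r => has (fun c =>
      [&& x \in r, y \in c & size [seq z <- r | z \in c] == 1]) cols) rows) l) l.

(* Each candidate in todo is laid one way, laid the other way or discarded.  A
   branch is cut as soon as a laid rectangle cannot be completed to a row or to a
   column.  (if, not &&: vm_compute evaluates both arguments of &&.) *)
Fixpoint search (n : N) (k : nat) (placed todo : seq (N * N)) : bool :=
  if k <= size placed + size todo then
    if all (completable n placed todo) placed then
      if todo is c :: todo' then
        [|| search n k (c :: placed) todo', search n k (transpose c :: placed) todo'
          | search n k placed todo']
      else crossing n placed
    else false
  else false.

(** * Completeness of the search *)

Section SearchComplete.

Variables (n k : nat) (w h : 'I_k -> nat) (row col : 'I_k -> {set 'I_k}).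
Hypothesis G : grid n w h row col.

Definition rectN (i : 'I_k) : N * N := (N.of_nat (w i), N.of_nat (h i)).

Lemma rectN_cong i j : rectN i = rectN j \/ rectN i = transpose (rectN j) -> i = j.
Proof. by rewrite /rectN /transpose => -[[/Nat2N.inj e _]|[/Nat2N.inj e _]]; apply: (grid_inj G); tauto. Qed.

Lemma rectN_inj : injective rectN.
Proof. by move=> i j e; apply: rectN_cong; left. Qed.

(** The decision about [c] that reproduces the given grid; it singles out one branch of the
    search. *)
Definition placement (c : N * N) : option (N * N) :=
  if c \in codom rectN then Some c
  else if transpose c \in codom rectN then Some (transpose c) else None.

Lemma placement_eq c x : placement c = Some x -> x = c \/ x = transpose c.
Proof. by rewrite /placement; case: ifP => _; [|case: ifP => _]; move=> [] //= <-; auto. Qed.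

Lemma subsum_cons t d o os : d \in o -> (N.to_nat d <= N.to_nat t) ->
  subsum (N.sub t d) os -> subsum t (o :: os).
Proof.
move=> dout dt st /=; case: ifP => // _.
have -> // : has (fun d0 : N => if N.leb d0 t then subsum (N.sub t d0) os else false) o.
by apply/hasP; exists d => //; have -> : N.leb d t by lia.
Qed.

Lemma subsum_skip t o os : subsum t os -> subsum t (o :: os).
Proof. by move=> /= ->; case: ifP => // _; case: ifP. Qed.

(** [P] stands for membership in a row or a column and [f] for the matching projection; the
    placements selected by [P] tell which alternatives to take. *)
Lemma subsum_placement (f : N * N -> N) (P : pred (N * N)) others todo t :
  (forall c, f c \in [:: c.1; c.2]) ->
  \sum_(y <- others ++ pmap placement todo | P y) N.to_nat (f y) = N.to_nat t ->
  subsum t ([seq [:: f y] | y <- others] ++ [seq [:: c.1; c.2] | c <- todo]).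
Proof.
move=> fP; elim: others t => [|y others IH] t; last first.
  rewrite map_cons !cat_cons big_cons; case: ifP => _ E; last exact/subsum_skip/IH.
  apply: (@subsum_cons _ (f y)); rewrite ?inE ?eqxx //; first by lia.
  by apply: IH; lia.
rewrite !cat0s; elim: todo t => [|c todo IH] t.
  by rewrite big_nil => E; have -> : t = 0%num by lia.
rewrite map_cons [pmap _ _]/=; case pc: (placement c) => [y|]; rewrite /oapp; last by move=> E; exact/subsum_skip/IH.
rewrite big_cons; case: ifP => _ E; last exact/subsum_skip/IH.
apply: (@subsum_cons _ (f y)); [|by lia|by apply: IH; lia].
have := fP y; case: (placement_eq pc) => -> //.
by rewrite !inE /= orbC.
Qed.

Lemma exact_sums_filter f (P : pred (N * N)) l t :
  \sum_(y <- l | P y) N.to_nat (f y) = N.to_nat t -> [seq y <- l | P y] \in exact_sums f t l.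
Proof.
elim: l t => [|y l IH] t /=.
  by rewrite big_nil => E; have -> : t = 0%num by lia.
rewrite big_cons mem_cat; case: ifP => _ E; last by rewrite IH ?orbT.
have -> : N.leb (f y) t by lia.
by rewrite map_f // IH //; lia.
Qed.

Let inrow i y := y \in [seq rectN j | j in row i].
Let incol i y := y \in [seq rectN j | j in col i].

Lemma sum_codom_row l i : perm_eq l (codom rectN) ->
  \sum_(y <- l | inrow i y) N.to_nat y.1 = n.
Proof.
move=> pl; rewrite (perm_big _ pl) /= big_map big_enum_cond /= -(grid_row G i).
apply: eq_big => [j|j _]; last by rewrite Nat2N.id.
by rewrite /inrow mem_map ?mem_enum //; apply: rectN_inj.
Qed.

Lemma sum_codom_col l i : perm_eq l (codom rectN) ->
  \sum_(y <- l | incol i y) N.to_nat y.2 = n.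
Proof.
move=> pl; rewrite (perm_big _ pl) /= big_map big_enum_cond /= -(grid_col G i).
apply: eq_big => [j|j _]; last by rewrite Nat2N.id.
by rewrite /incol mem_map ?mem_enum //; apply: rectN_inj.
Qed.

Lemma completable_true placed todo x :
  perm_eq (placed ++ pmap placement todo) (codom rectN) -> x \in placed ->
  completable (N.of_nat n) placed todo x.
Proof.
move=> pl xp; have pl' : perm_eq (x :: rem x placed ++ pmap placement todo) (codom rectN).
  by rewrite -cat_cons -(permPr pl) perm_cat2r perm_sym perm_to_rem.
have /codomP [i xi] : x \in codom rectN by rewrite -(perm_mem pl') mem_head.
rewrite /completable.
have -> : subsum (N.of_nat n - x.1)%num
   ([seq [:: y.1] | y <- rem x placed] ++ [seq [:: c.1; c.2] | c <- todo]).
  apply: (@subsum_placement fst (inrow i)) => [c|]; first by rewrite !inE eqxx.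
  have := sum_codom_row i pl'; rewrite big_cons.
  have -> : inrow i x by rewrite xi /inrow mem_map ?mem_enum ?(grid_rowi G) //; apply: rectN_inj.
  by move=> <-; rewrite N2Nat.inj_sub Nat2N.id; apply/esym/addKn.
apply: (@subsum_placement snd (incol i)) => [c|]; first by rewrite !inE eqxx orbT.
have := sum_codom_col i pl'; rewrite big_cons.
have -> : incol i x by rewrite xi /incol mem_map ?mem_enum ?(grid_coli G) //; apply: rectN_inj.
by move=> <-; rewrite N2Nat.inj_sub Nat2N.id; apply/esym/addKn.
Qed.

Lemma crossing_true l : perm_eq l (codom rectN) -> crossing (N.of_nat n) l.
Proof.
move=> pl; have ul : uniq l by rewrite (perm_uniq pl) map_inj_uniq ?enum_uniq //; apply: rectN_inj.
apply/allP => x; rewrite (perm_mem pl) => /codomP [i ->].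
apply/allP => y; rewrite (perm_mem pl) => /codomP [j ->].
apply/hasP; exists [seq z <- l | inrow i z].
  by apply: exact_sums_filter; rewrite (sum_codom_row i pl) Nat2N.id.
apply/hasP; exists [seq z <- l | incol j z].
  by apply: exact_sums_filter; rewrite (sum_codom_col j pl) Nat2N.id.
rewrite !mem_filter !(perm_mem pl) !codom_f !andbT.
rewrite {1}/inrow {1}/incol !mem_map ?mem_enum ?(grid_rowi G) ?(grid_coli G) /=; try exact: rectN_inj.
have /cards1P [m /setP rc] := introT eqP (grid_cross G i j).
have E z : z \in l -> inrow i z && incol j z = (z == rectN m).
  rewrite (perm_mem pl) => /codomP [a ->]; have := rc a.
  rewrite /inrow /incol !mem_map ?mem_enum ?inE; try exact: rectN_inj.
  by move=> ->; rewrite (inj_eq rectN_inj).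
rewrite -filter_predI (@eq_in_filter _ _ (pred1 (rectN m))) => [|z zl].
  by rewrite filter_pred1_uniq // (perm_mem pl) codom_f.
by rewrite /= mem_filter zl andbT -E // andbC.
Qed.

(** Along the branch given by [placement], the rectangles laid so far and those still to come make
    up exactly the grid, so no test cuts it. *)
Lemma search_placement placed todo :
  perm_eq (placed ++ pmap placement todo) (codom rectN) ->
  search (N.of_nat n) k placed todo.
Proof.
elim: todo placed => [|c todo IH] placed pl.
  rewrite /= addn0 -[X in X <= _]card_ord -(size_codom rectN) -(perm_size pl) cats0 leqnn.
  rewrite (introT allP (fun x => completable_true pl)) crossing_true //.
  by rewrite cats0 in pl.
have sz : k <= size placed + size (c :: todo).
  rewrite -[X in X <= _]card_ord -(size_codom rectN) -(perm_size pl) size_cat.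
  by rewrite leq_add2l size_pmap count_size.
rewrite /= in sz *; rewrite sz (introT allP (fun x => completable_true pl)).
move: pl; rewrite /=; case pc: (placement c) => [y|] /= pl; last by rewrite (IH placed) ?orbT.
have {}pl : perm_eq (y :: placed ++ pmap placement todo) (codom rectN).
  by rewrite -(permPr pl) perm_sym perm_catC /= perm_cons perm_catC.
by case: (placement_eq pc) pl => -> pl; rewrite (IH (_ :: placed) pl) ?orbT.
Qed.

(** Distinctness of the candidates and their transposes (in particular, no candidate is a square)
    ensures that no rectangle arises from two candidates. *)
Lemma perm_placement cs :
  uniq (cs ++ map transpose cs) ->
  (forall i, rectN i \in cs ++ map transpose cs) ->
  perm_eq (pmap placement cs) (codom rectN).
Proof.
have transposeK : involutive transpose by case.
move=> ucs rcs; apply: uniq_perm; last 1 first.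
- move=> x; rewrite mem_pmap; apply/mapP/codomP => [[c ccs]|[i xi]].
    rewrite /placement; case: ifP => [/codomP[i ->] [->]|_]; first by exists i.
    by case: ifP => // /codomP[i ->] [->]; exists i.
  have := rcs i; rewrite mem_cat -xi => /orP[xcs|/mapP[c ccs xc]].
    by exists x => //; rewrite /placement xi codom_f.
  exists c => //; rewrite /placement -xc xi codom_f; case: ifP => // /codomP[j cj].
  have ij : i = j by apply: rectN_cong; right; rewrite -xi xc cj.
  move: ucs; rewrite cat_uniq => /and3P[_ /hasPn/(_ (transpose c)) D _].
  by move: D; rewrite map_f // -xc xi ij -cj ccs => /(_ isT).
- elim: cs ucs {rcs} => //= c cs IH.
  rewrite mem_cat negb_or cat_uniq [_ \in _ :: _]inE !negb_or -!andbA.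
  move=> /and5P[c1 _ c3 u1 /and4P[c4 hs c5 u2]].
  have {}IH : uniq (pmap placement cs) by apply: IH; rewrite cat_uniq u1 hs.
  case pc: (placement c) => [y|] //=; rewrite IH andbT mem_pmap; apply/mapP => -[d dcs].
  move=> /esym /placement_eq pd; case: (placement_eq pc) pd => -> [] E.
  + by rewrite E dcs in c1.
  + by rewrite E map_f in c3.
  + by rewrite E dcs in c4.
  + by rewrite E map_f in c5.
- by rewrite map_inj_uniq ?enum_uniq //; apply: rectN_inj.
Qed.

Lemma search_complete cs :
  uniq (cs ++ map transpose cs) ->
  (forall i, rectN i \in cs ++ map transpose cs) ->
  search (N.of_nat n) k [::] cs.
Proof. by move=> ucs rcs; apply/search_placement/perm_placement. Qed.

End SearchComplete.

(** * Candidates from side ratios, and counting *)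

Definition toN (x : nat * nat) : N * N := (N.of_nat x.1, N.of_nat x.2).

(* The sides D u and k D / u of a rectangle, for the fraction u = x.1 / x.2. *)
Definition candidate (D k : N) (x : N * N) : N * N :=
  (N.div (N.mul D x.1) x.2, N.div (N.mul (N.mul k D) x.2) x.1).

Definition excluded (D k : N) (l : seq (N * N)) : bool :=
  let cs := map (candidate D k) l in
  uniq (cs ++ map transpose cs) && ~~ search (N.mul k D) (N.to_nat k) [::] cs.

(** Both quotients are exact, the second because the product of the sides turns the equation for [e]
    into one for [e']. *)
Lemma candidateE D k x e e' :
  0 < D -> 0 < x.1 -> 0 < x.2 -> e * e' = k * D ^ 2 -> e * x.2 = D * x.1 ->
  candidate (N.of_nat D) (N.of_nat k) (toN x) = (N.of_nat e, N.of_nat e').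
Proof.
move=> D0 x1 x2 ee ex.
have ex' : e' * x.1 = k * D * x.2.
  apply/eqP; rewrite -(@eqn_pmul2l D) //; apply/eqP; nia.
rewrite /candidate /toN /= -!Nat2N.inj_mul.
rewrite -[(D * x.1)%coq_nat]/(D * x.1) -ex -[((k * D)%coq_nat * x.2)%coq_nat]/(k * D * x.2) -ex'.
rewrite ![N.of_nat (_ * _)]Nat2N.inj_mul !N.div_mul //; lia.
Qed.

Lemma excluded_no_grid D k (w h : 'I_k -> nat) row col (l : seq (nat * nat)) :
  grid (k * D) w h row col ->
  (forall i, exists2 x, x \in l & [/\ 0 < x.1, 0 < x.2 &
    w i * x.2 = D * x.1 \/ h i * x.2 = D * x.1]) ->
  excluded (N.of_nat D) (N.of_nat k) (map toN l) -> False.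
Proof.
move=> G lP /andP[ucs /negP[]].
rewrite Nat2N.id -Nat2N.inj_mul; apply: (search_complete G ucs) => i.
have [x xl [x1 x2 ex]] := lP i; set f := candidate _ _.
have k0 := ltnW (grid_k G).
have D0 : 0 < D by have := grid_n_gt0 G i; rewrite muln_gt0 => /andP[].
have A : w i * h i = k * D ^ 2.
  by apply/eqP; rewrite -(@eqn_pmul2l k) // (grid_area G) expnMn mulnA mulnn.
have fx : f (toN x) \in map f (map toN l) by rewrite map_f // map_f.
rewrite mem_cat; case: ex => ex; apply/orP; [left|right].
  by rewrite /rectN -(candidateE D0 x1 x2 A ex).
rewrite mulnC in A; apply/mapP; exists (f (toN x)) => //.
by rewrite /f (candidateE D0 x1 x2 A ex).
Qed.

(** A fraction determines the side and the chosen sides are distinct, so at least [k] fractions are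
    needed. *)
Lemma leq_count_sides k (e : 'I_k -> nat) D (l : seq (nat * nat)) (P : pred (nat * nat)) :
  injective e ->
  (forall i, exists2 x, x \in l & [&& P x, 0 < x.2 & e i * x.2 == D * x.1]) ->
  k <= count P l.
Proof.
move=> einj lP; rewrite -size_filter -(size_map (fun x => D * x.1 %/ x.2)).
rewrite -{1}(card_ord k) -(size_codom e); apply: uniq_leq_size.
  by rewrite map_inj_uniq ?enum_uniq.
move=> y /codomP[i ->]; have [x xl /and3P[Px x0 /eqP ex]] := lP i.
by apply/mapP; exists x; rewrite ?mem_filter ?Px // -ex mulnK.
Qed.

(** * Divisors of the square of a product of three primes *)

Lemma dvdn_mul_split d a b : 0 < d -> d %| a * b ->
  exists d1 d2, [/\ d1 %| a, d2 %| b & d = d1 * d2].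
Proof.
move=> d0 dab; have g0 : 0 < gcdn d a by rewrite gcdn_gt0 d0.
exists (gcdn d a), (d %/ gcdn d a); split; first exact: dvdn_gcdr.
  rewrite -(@Gauss_dvdr _ (a %/ gcdn d a)); last first.
    rewrite /coprime -(eqn_pmul2r g0) mul1n muln_gcdl !divnK ?dvdn_gcdl ?dvdn_gcdr //.
  by rewrite -(dvdn_pmul2r g0) divnK ?dvdn_gcdl // mulnAC divnK ?dvdn_gcdr.
by rewrite mulnC divnK ?dvdn_gcdl.
Qed.

Lemma dvdn_pfactor_mul d p e m : prime p -> 0 < d -> d %| p ^ e * m ->
  exists a d', [/\ a <= e, d' %| m & d = p ^ a * d'].
Proof.
move=> pp d0 /(dvdn_mul_split d0)[d1 [d2 [/(dvdn_pfactor _ _ pp)[a ae ->] d2m ->]]].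
by exists a, d2.
Qed.

Lemma dvdn_sq3 d q r s : prime q -> prime r -> prime s -> d %| (q * r * s) ^ 2 ->
  exists a b c, [/\ a <= 2, b <= 2, c <= 2 & d = q ^ a * (r ^ b * s ^ c)].
Proof.
move=> pq pr ps; rewrite !expnMn -mulnA => dD.
have d0 : 0 < d by apply: dvdn_gt0 dD; rewrite !muln_gt0 ?expn_gt0 !prime_gt0.
have [a [d1 [a2 dD1 E1]]] := dvdn_pfactor_mul pq d0 dD.
have d10 : 0 < d1 by move: d0; rewrite E1 muln_gt0 => /andP[].
have [b [d2 [b2 dD2 E2]]] := dvdn_pfactor_mul pr d10 dD1.
have [c c2 E3] := dvdn_pfactor _ _ ps dD2.
by exists a, b, c; rewrite E1 E2 E3.
Qed.

(* Up to inversion, the fractions q^a r^b s^c with exponents in {-1,0,1} (q < r < s). *)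
Definition ratios (q r s : nat) : seq (nat * nat) :=
  [:: (1, 1); (q, 1); (r, 1); (s, 1); (q * r, 1); (q * s, 1); (r * s, 1); (q * r * s, 1);
      (r, q); (s, q); (s, r); (q * r, s); (s, q * r); (q * s, r); (r * s, q)].

(** From each inverse pair among the 27 fractions only the one that is at least 1 can occur. The
    order of the primes decides which, except between qr/s and s/(qr); hence 15 entries instead of
    14. *)
Lemma ratiosP q r s e : prime q -> prime r -> prime s -> q < r < s ->
  e %| (q * r * s) ^ 2 -> q * r * s <= e ->
  exists2 x, x \in ratios q r s & [&& 0 < x.1, 0 < x.2 & e * x.2 == q * r * s * x.1].
Proof.
move=> pq pr ps /andP[qr rs] /(dvdn_sq3 pq pr ps)[a [b [c [a2 b2 c2 eE]]]].
have q1 := prime_gt1 pq; have r1 := prime_gt1 pr; have s1 := prime_gt1 ps.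
(* [num t m] over [den t m] is t^(m-1) for m at most 2: dividing by the product of the primes lowers
   each exponent by one. *)
pose num t m := if m == 2 then t else 1; pose den t m := if m == 0 then t else 1.
have numden t m : m <= 2 -> t ^ m * den t m = t * num t m.
  by case: m => [|[|[|]]] //= _; rewrite /num /den /= ?expn0 ?expn1 -?mulnn ?muln1 ?mul1n.
have num0 t m : 1 < t -> 0 < num t m by rewrite /num; case: ifP => // _ /ltnW.
have den0 t m : 1 < t -> 0 < den t m by rewrite /den; case: ifP => // _ /ltnW.
set u := num q a * num r b * num s c; set v := den q a * den r b * den s c.
have uv : e * v = q * r * s * u.
  transitivity (q ^ a * den q a * (r ^ b * den r b) * (s ^ c * den s c)).
    by rewrite eE /v; lia.
  by rewrite !numden // /u; lia.
have u0 : 0 < u by rewrite /u !muln_gt0 !num0.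
have v0 : 0 < v by rewrite /v !muln_gt0 !den0.
move=> De; have {De} vu : v <= u.
  rewrite -(@leq_pmul2l (q * r * s)) ?muln_gt0 ?(ltnW q1) ?(ltnW r1) ?(ltnW s1) //.
  by rewrite -uv leq_mul2r De orbT.
exists (u, v); last by rewrite /= u0 v0 uv eqxx.
have qrs : q < r * s by nia.
have rqs : r < q * s by nia.
have qr1 : 1 < q * r by nia.
have rs1 : 1 < r * s by nia.
have qs1 : 1 < q * s by nia.
have qrs1 : 1 < q * r * s by nia.
move: vu; rewrite {uv u0 v0 eE}/u {}/v /num /den {num den numden num0 den0}.
case: a a2 => [|[|[|]]] // _; case: b b2 => [|[|[|]]] // _; case: c c2 => [|[|[|]]] // _;
  rewrite /= ?muln1 ?mul1n => vu; first [by exfalso; lia | by rewrite !inE eqxx ?orbT].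
Qed.

(* A side of length (n/k) u is compatible with grid_width_gap. *)
Definition admissible (k : nat) (x : nat * nat) : bool :=
  (x.1 == x.2) || (k * x.2 <= k.-1 * x.1) && (x.1 <= k.-1 * x.2).

Definition admissibleN (k : N) (x : N * N) : bool :=
  N.eqb x.1 x.2 ||
  N.leb (N.mul k x.2) (N.mul (N.pred k) x.1) && N.leb x.1 (N.mul (N.pred k) x.2).

Definition ratiosN (q r s : N) : seq (N * N) :=
  let qr := N.mul q r in let qs := N.mul q s in let rs := N.mul r s in
  [:: (1, 1); (q, 1); (r, 1); (s, 1); (qr, 1); (qs, 1); (rs, 1); (N.mul qr s, 1);
      (r, q); (s, q); (s, r); (qr, s); (s, qr); (qs, r); (rs, q)]%num.

(** The count comes first, so that the search runs only on triples that counting cannot exclude. *)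
Definition sweep (p : N) (qs rs ss : seq N) : bool :=
  all (fun q => all (fun r => all (fun s =>
    if [&& N.ltb q r, N.ltb r s & p \notin [:: q; r; s]] then
      let l := filter (admissibleN p) (ratiosN q r s) in
      if N.to_nat p <= size l then excluded (N.mul (N.mul q r) s) p l else true
    else true) ss) rs) qs.

Definition primesN (m : nat) : seq N := map N.of_nat (filter prime (iota 0 m)).

Lemma primesN_mem m q : prime q -> q < m -> N.of_nat q \in primesN m.
Proof. by move=> pq qm; apply: map_f; rewrite mem_filter pq mem_iota. Qed.

Lemma admissible_toN k : preim toN (admissibleN (N.of_nat k)) =1 admissible k.
Proof. by move=> [a b]; rewrite /admissible /admissibleN /toN /=; lia. Qed.

Lemma ratios_toN q r s :
  map toN (ratios q r s) = ratiosN (N.of_nat q) (N.of_nat r) (N.of_nat s).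
Proof. by rewrite /ratiosN -!Nat2N.inj_mul. Qed.

(** * Prime number of rectangles: the possible ratios *)

Section SimplePrime.

Variables (q r s p : nat).
Hypotheses (pq : prime q) (pr : prime r) (ps : prime s) (pp : prime p).
Hypotheses (qr : q < r) (rs : r < s) (npq : p != q) (npr : p != r) (nps : p != s).
Local Notation D := (q * r * s).
Variables (w h : 'I_p -> nat) (row col : 'I_p -> {set 'I_p}).
Hypothesis G : grid (p * D) w h row col.

Let G' := grid_transpose G.

(** The area p D^2 contains p exactly once, so exactly one side is prime to p, and that side divides
    D^2. *)
Definition free_side (i : 'I_p) := if p %| w i then h i else w i.

Lemma D_gt0 : 0 < D.
Proof. by rewrite !muln_gt0 !prime_gt0. Qed.

Lemma simple_area i : w i * h i = p * D ^ 2.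
Proof.
by apply/eqP; rewrite -(@eqn_pmul2l p) ?prime_gt0 // (grid_area G) expnMn mulnA mulnn.
Qed.

Lemma p_ndvd_D : ~~ (p %| D).
Proof. by rewrite !Euclid_dvdM // !dvdn_prime2 // !negb_or npq npr. Qed.

Lemma free_side_dvd i : free_side i %| D ^ 2 /\ ~~ (p %| free_side i).
Proof.
have A := simple_area i; have nD := p_ndvd_D; have p0 := prime_gt0 pp.
rewrite /free_side; case: ifP => pw; last first.
  split; last by rewrite pw.
  have cop : coprime (w i) p by rewrite coprime_sym prime_coprime ?pw.
  by rewrite -(Gauss_dvdr _ cop) -A dvdn_mulr.
have {}A : w i %/ p * h i = D ^ 2.
  by apply/eqP; rewrite -(@eqn_pmul2l p) // mulnA [p * (_ %/ _)]mulnC divnK // A.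
have hD : h i %| D ^ 2 by rewrite -A dvdn_mull.
split=> //; apply: contra nD => ph.
by have := dvdn_trans ph hD; rewrite Euclid_dvdX // => /andP[].
Qed.

Lemma free_side_inj : injective free_side.
Proof.
by apply: (grid_choose_side_inj G) => i; rewrite /free_side; case: ifP => _; [right|left].
Qed.

Lemma free_side_ge i : D <= free_side i.
Proof.
rewrite -(@leq_pmul2l p) ?prime_gt0 // /free_side.
by case: ifP => _; [apply: (grid_width_ge G') | apply: (grid_width_ge G)].
Qed.

(** The upper bound is the gap for the free side, which is not n because p divides n. The lower
    bound is the gap for the other side; if that side is n, the free side is D and the ratio is
    1. *)
Lemma simple_ratio i : exists2 x, x \in ratios q r s &
  [/\ 0 < x.1, 0 < x.2, admissible p x & free_side i * x.2 = D * x.1].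
Proof.
have [eD pe] := free_side_dvd i.
have [x xin /and3P[x1 x2 /eqP ex]] := ratiosP pq pr ps (introT andP (conj qr rs)) eD (free_side_ge i).
exists x => //; split=> //.
have D0 := D_gt0; have p1 := prime_gt1 pp.
have gap : free_side i <= p.-1 * D.
  have : free_side i = p * D \/ p * free_side i <= p.-1 * (p * D).
    rewrite /free_side; case: ifP => _.
      exact: (grid_width_gap G').
    exact: (grid_width_gap G).
  case=> [E|]; first by rewrite E dvdn_mulr in pe.
  by rewrite mulnCA leq_pmul2l // ltnW.
have gap' : free_side i = D \/ p * D <= p.-1 * free_side i.
  set e' := (w i * h i) %/ free_side i.
  have ee : free_side i * e' = p * D ^ 2.
    rewrite -(simple_area i) mulnC divnK // /free_side.
    by case: ifP => _; [apply: dvdn_mull|apply: dvdn_mulr].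
  have e0 : 0 < free_side i by rewrite (leq_trans D0) ?free_side_ge.
  have : e' = p * D \/ p * e' <= p.-1 * (p * D).
    rewrite /e' /free_side; case: ifP => _.
      by rewrite mulnK ?(grid_h G) //; apply: (grid_width_gap G).
    by rewrite mulKn ?(grid_w G) //; apply: (grid_width_gap G').
  case=> [E|E].
    left; apply/eqP; rewrite -(@eqn_pmul2r (p * D)) ?muln_gt0 ?prime_gt0 //.
    by rewrite -E ee E; nia.
  right; rewrite mulnCA leq_pmul2l ?prime_gt0 // in E.
  rewrite -(@leq_pmul2r D) // -mulnA mulnn -ee -mulnA mulnCA leq_mul2l E orbT.
  by [].
rewrite /admissible; case: gap' => E.
  by move: ex; rewrite E => /eqP; rewrite eqn_pmul2l // eq_sym => ->.
apply/orP; right; apply/andP; split.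
  rewrite -(@leq_pmul2l D) //.
  by rewrite mulnCA [D * (_ * x.1)]mulnCA -ex mulnA [p.-1 * _]mulnA leq_mul2r E orbT.
by rewrite -(@leq_pmul2l D) // -ex [D * _]mulnCA mulnA leq_mul2r gap orbT.
Qed.

Lemma simple_count : p <= count (admissible p) (ratios q r s).
Proof.
apply: (leq_count_sides (D := D) free_side_inj) => i.
by have [x xin [x1 x2 ax /eqP ex]] := simple_ratio i; exists x => //; rewrite ax x2.
Qed.

Lemma sweep_contra mq mr ms :
  q < mq -> r < mr -> s < ms ->
  sweep (N.of_nat p) (primesN mq) (primesN mr) (primesN ms) -> False.
Proof.
move=> qm rm sm /allP/(_ _ (primesN_mem pq qm)) /allP/(_ _ (primesN_mem pr rm)).
move=> /allP/(_ _ (primesN_mem ps sm)).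
have -> : N.ltb (N.of_nat q) (N.of_nat r) by lia.
have -> : N.ltb (N.of_nat r) (N.of_nat s) by lia.
have -> : N.of_nat p \notin [:: N.of_nat q; N.of_nat r; N.of_nat s].
  by rewrite !inE !negb_or; apply/and3P; split; apply/eqP; lia.
lazy beta iota zeta delta [andb]; rewrite -ratios_toN filter_map (eq_filter (admissible_toN p)) Nat2N.id size_map size_filter.
rewrite simple_count -!Nat2N.inj_mul.
apply: (excluded_no_grid G) => i.
have [x xin [x1 x2 ax ex]] := simple_ratio i; exists x; first by rewrite mem_filter ax.
by split=> //; move: ex; rewrite /free_side; case: ifP; tauto.
Qed.

End SimplePrime.

(** The ranges of this and the next two computations are those left by the counts in
    [simple_prime5], [simple_prime7] and [simple_prime11]. *)
Lemma sweep5 : sweep (N.of_nat 5) (primesN 17) (primesN 17) (primesN 145).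
Proof. by vm_cast_no_check (erefl true). Qed.

Lemma sweep7 : sweep (N.of_nat 7) (primesN 6) (primesN 31) (primesN 91).
Proof. by vm_cast_no_check (erefl true). Qed.

Lemma sweep11 : sweep (N.of_nat 11) (primesN 11) (primesN 11) (primesN 11).
Proof. by vm_cast_no_check (erefl true). Qed.

Lemma admissible_le p x y : 1 < p -> admissible p (x, y) -> y <= x <= p.-1 * y.
Proof. by move=> p1 /orP[/eqP /= ->|/andP[/= A B]]; [nia | rewrite B andbT; nia]. Qed.

(** Every rectangle turns out to have a side n; then all are congruent. *)
Lemma grid3_false n (w h : 'I_3 -> nat) row col : ~ grid n w h row col.
Proof.
move=> G; have G' := grid_transpose G.
have n0 := grid_n_gt0 G ord0.
(* If neither side of [i] is n, both are at least n/2. A neighbour of [i] in its row is then a full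
   strip, since otherwise both would have width exactly n/2. *)
have aux (u v : 'I_3 -> nat) ro co i :
    grid n u v ro co -> u i != n -> v i != n -> exists j, v j = n.
  move=> H ui vi; have H' := grid_transpose H.
  have half l : u l != n -> v l != n -> n <= 2 * u l.
    move=> ul vl; have := grid_area H l.
    by case: (grid_width_gap H' l) => [E|]; [rewrite E eqxx in vl | nia].
  have [j _ /andP[ij uij]] := grid_neighbour H ui; exists j.
  have hi := half i ui vi.
  apply/eqP; apply: contraT => vj; have uj : u j != n by lia.
  have hj := half j uj vj; have E : u i = u j by lia.
  by move: ij; rewrite (grid_inj H (or_introl E)) eqxx.
have strip i : w i = n \/ h i = n.
  case: (eqVneq (w i) n) => [|wi]; first by left.
  case: (eqVneq (h i) n) => [|hi]; first by right.
  have [j hj] := aux _ _ _ _ _ G wi hi; have [l wl] := aux _ _ _ _ _ G' hi wi.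
  have Aj := grid_area G j; have Al := grid_area G l.
  (* Two full strips in different directions are congruent, hence equal, and would be the whole
     square. *)
  have E : w j = h l by rewrite hj in Aj; rewrite wl in Al; nia.
  have jl := grid_inj G (or_intror E); subst l.
  by exfalso; rewrite hj wl in Aj; nia.
have A0 := grid_area G ord0; have A1 := grid_area G (inord 1).
have : ord0 = inord 1 :> 'I_3.
  case: (strip ord0) (strip (inord 1)) => [E0|E0] [E1|E1].
  - by apply: (grid_inj G); left; rewrite E0.
  - by apply: (grid_inj G); right; rewrite E0 E1.
  - by apply: (grid_inj G'); right; rewrite E0 E1.
  - by apply: (grid_inj G'); left; rewrite E0.
by move/(congr1 val); rewrite /= inordK.
Qed.

Lemma third_prime_ge5 q r s : prime q -> prime s -> q < r -> r < s -> 5 <= s.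
Proof.
by move=> /prime_gt1 q1 ps qr rs; have s4 : s != 4 by [apply: contraTneq ps => ->]; lia.
Qed.

Lemma prime_neq_mul q r s : prime q -> prime s -> q < s -> s != q * r.
Proof.
move=> pq ps qs; apply/eqP => E; have : q %| s by rewrite E dvdn_mulr.
by rewrite dvdn_prime2 // ltn_eqF.
Qed.

(** * The infinite family, by divisibility of row sums *)

Section SimplePrimeContra.

Variables (q r s p : nat).
Hypotheses (pq : prime q) (pr : prime r) (ps : prime s) (pp : prime p).
Hypotheses (qr : q < r) (rs : r < s) (npq : p != q) (npr : p != r) (nps : p != s).
Local Notation D := (q * r * s).

Let q1 : 1 < q := prime_gt1 pq.
Let p1 : 1 < p := prime_gt1 pp.

(** The ratios that stay possible for k = 5 when r > 4q. *)
Definition five_ratios := [:: (1, 1); (q, 1); (s, r); (q * r, s); (q * s, r)].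

Lemma ratio_other_side (w h : 'I_p -> nat) row col i :
  grid (p * D) w h row col -> exists2 x, x \in ratios q r s & exists e e',
   [/\ admissible p x, e * x.2 = D * x.1, e' * x.1 = p * D * x.2 &
       (w i = e /\ h i = e') \/ (w i = e' /\ h i = e)].
Proof.
move=> G; have [x xin [x1 x2 ax ex]] := simple_ratio pq pr ps pp qr rs npq npr nps G i.
have A := simple_area pp G i; have D0 := D_gt0 pq pr ps.
have other e e' : e * e' = p * D ^ 2 -> e * x.2 = D * x.1 -> e' * x.1 = p * D * x.2.
  by move=> ee E; apply/eqP; rewrite -(@eqn_pmul2l D) //; apply/eqP; nia.
exists x => //; move: ex; rewrite /free_side; case: ifP => _ ex.
  exists (h i), (w i); split=> //; last by right.
  by apply: other ex; rewrite mulnC.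
by exists (w i), (h i); split=> //; [apply: other ex | left].
Qed.

(* In a row, the widths prime to r add up to a multiple of r; being multiples
   of s ^ 2 as well, they would fill more than the whole row. *)
Lemma r_dvd_widths (w h : 'I_p -> nat) row col i :
  grid (p * D) w h row col -> p * q < s ->
  {in ratios q r s, forall x, admissible p x -> x \in five_ratios} -> r %| w i.
Proof.
move=> G pqs five; have D0 := D_gt0 pq pr ps.
have r0 := prime_gt0 pr; have s0 := prime_gt0 ps; have q0 := prime_gt0 pq; have p0 := prime_gt0 pp.
have dr a : r %| a * r := dvdn_mull a (dvdnn r).
have ds a : s ^ 2 %| a * s ^ 2 := dvdn_mull a (dvdnn _).
(* For each of the five ratios u, both D u and p D / u contain the factor r or the factor s^2. *)
have dich j : ~~ (r %| w j) -> s ^ 2 %| w j.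
  have [x xin [e [e' [ax ex ex' wh]]]] := ratio_other_side j G.
  have {xin ax} := five x xin ax; rewrite !inE => xin.
  suff [E E'] : (r %| e) || (s ^ 2 %| e) /\ (r %| e') || (s ^ 2 %| e').
    by case: wh => -[-> _]; move: E E'; case: (r %| e); case: (r %| e').
  have solve z c y : 0 < c -> z * c = y * c -> z = y.
    by move=> c0 /eqP; rewrite eqn_pmul2r // => /eqP.
  case/or4P: xin ex ex' => [/eqP->|/eqP->|/eqP->|/orP[/eqP->|/eqP->]] /= ex ex'.
  - have -> : e = q * s * r by lia.
    have -> : e' = p * q * s * r by lia.
    by rewrite !dr.
  - have -> : e = q * q * s * r by lia.
    have -> : e' = p * s * r by apply: (solve _ _ _ q0); lia.
    by rewrite !dr.
  - have E : e = q * s ^ 2 by apply: (solve _ _ _ r0); lia.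
    have -> : e' = p * q * r * r by apply: (solve _ _ _ s0); lia.
    by rewrite E dr ds ?orbT.
  - have E : e = q * q * r * r by apply: (solve _ _ _ s0); lia.
    have -> : e' = p * s ^ 2 by apply: (@solve _ (q * r)); rewrite ?muln_gt0 ?q0 //; lia.
    by rewrite E dr ds ?orbT.
  - have E : e = q * q * s ^ 2 by apply: (solve _ _ _ r0); lia.
    have -> : e' = p * r * r by apply: (@solve _ (q * s)); rewrite ?muln_gt0 ?q0 //; lia.
    by rewrite E dr ds ?orbT.
apply: contraT => nri; have := grid_row G i.
rewrite (bigID (fun j => r %| w j)) /=; set S1 := \sum_(_ | _) _; set S2 := \sum_(_ | _) _ => S12.
have rS1 : r %| S1 by apply: dvdn_sum => j /andP[].
have rS2 : r %| S2.
  have : r %| S1 + S2 by rewrite S12 mulnAC mulnA dr.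
  by rewrite dvdn_addr.
have sS2 : s ^ 2 %| S2.
  by apply: dvdn_sum => j /andP[_ /dich].
have rsS2 : r * s ^ 2 %| S2.
  rewrite Gauss_dvd ?rS2 //.
  by rewrite coprimeXr // prime_coprime // dvdn_prime2 // ltn_eqF.
have S20 : 0 < S2.
  by rewrite /S2 (bigD1 i) /= ?(grid_rowi G) // addn_gt0 (grid_w G).
have S2le : S2 <= p * D by rewrite -S12 leq_addl.
have : p * D < r * s ^ 2.
  have -> : p * D = p * q * (r * s) by lia.
  have -> : r * s ^ 2 = s * (r * s) by lia.
  by rewrite ltn_pmul2r // muln_gt0 r0.
by rewrite ltnNge (leq_trans (dvdn_leq S20 rsS2) S2le).
Qed.

Variables (w h : 'I_p -> nat) (row col : 'I_p -> {set 'I_p}).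
Hypothesis G : grid (p * D) w h row col.

(** All sides being multiples of r rules out the three ratios that involve r and s; the two left are
    too few. *)
Lemma five_ratios_contra : 2 < p -> p * q < s ->
  {in ratios q r s, forall x, admissible p x -> x \in five_ratios} -> False.
Proof.
move=> p2 pqs five; have G' := grid_transpose G.
have r0 := prime_gt0 pr; have s0 := prime_gt0 ps; have q0 := prime_gt0 pq.
have solve z c y : 0 < c -> z * c = y * c -> z = y.
  by move=> c0 /eqP; rewrite eqn_pmul2r // => /eqP.
have rq : (r %| q) = false by rewrite dvdn_prime2 //; lia.
have rp : (r %| p) = false by rewrite dvdn_prime2 // eq_sym (negbTE npr).
have rs' : (r %| s) = false by rewrite dvdn_prime2 // ltn_eqF.
suff : p <= count predT [:: (1, 1); (q, 1)] by rewrite /=; lia.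
apply: (leq_count_sides (D := D) (free_side_inj (w := w) (h := h) G)) => i.
have [x xin [x1 x2 ax ex]] := simple_ratio pq pr ps pp qr rs npq npr nps G i.
exists x; last by rewrite /= x2 ex eqxx.
have rw := r_dvd_widths i G pqs five; have rh := r_dvd_widths i G' pqs five.
have A := simple_area pp G i.
have re : r %| free_side w h i by rewrite /free_side; case: ifP.
have {xin ax} := five x xin ax; rewrite !inE.
case/or4P => [->|->|/eqP E|/orP[/eqP E|/eqP E]]; rewrite ?orbT //; exfalso; rewrite E /= in ex.
- have E' : free_side w h i = q * s ^ 2 by apply: (solve _ _ _ r0); rewrite ex; clear; lia.
  by move: re; rewrite E' Euclid_dvdM // Euclid_dvdX // rq rs'.
(* Here it is the other side, p s^2, that r fails to divide. *)
- have E' : free_side w h i = q ^ 2 * r ^ 2 by apply: (solve _ _ _ s0); rewrite ex; clear; lia.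
  have : r * free_side w h i %| w i * h i.
    by rewrite /free_side; case: ifP => _; [rewrite dvdn_mul | rewrite mulnC dvdn_mul].
  rewrite A E'.
  have -> : p * D ^ 2 = p * s ^ 2 * (q ^ 2 * r ^ 2) by clear; lia.
  rewrite dvdn_pmul2r ?muln_gt0 ?expn_gt0 ?q0 ?r0 //.
  by rewrite Euclid_dvdM // Euclid_dvdX // rp rs'.
- have E' : free_side w h i = q ^ 2 * s ^ 2 by apply: (solve _ _ _ r0); rewrite ex; clear; lia.
  by move: re; rewrite E' Euclid_dvdM // !Euclid_dvdX // rq rs'.
Qed.

End SimplePrimeContra.

Lemma inadmissible p x y : 1 < p -> (x < y) || (p.-1 * y < x) -> admissible p (x, y) = false.
Proof. by move=> p1 H; apply/negP => /(admissible_le p1); move: H; clear; lia. Qed.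

Arguments admissible : simpl never.

(* Abstracts every indicator as a number at most 1, so that lia need not split on booleans. *)
Ltac indicator_lia := rewrite /= ?addn0;
  repeat match goal with |- context [nat_of_bool ?b] =>
    move: (leq_b1 b); move: (nat_of_bool b) => ? end; clear; lia.

(** * Elimination of each prime number of rectangles *)

Section SimplePrimeFalse.

Variables (q r s p : nat).
Hypotheses (pq : prime q) (pr : prime r) (ps : prime s) (pp : prime p).
Hypotheses (qr : q < r) (rs : r < s) (npq : p != q) (npr : p != r) (nps : p != s).
Local Notation D := (q * r * s).
Variables (w h : 'I_p -> nat) (row col : 'I_p -> {set 'I_p}).
Hypothesis G : grid (p * D) w h row col.

Let q1 : 1 < q := prime_gt1 pq.
Let p1 : 1 < p := prime_gt1 pp.
Let s5 : 5 <= s := third_prime_ge5 pq ps qr rs.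
Local Notation adm := (admissible p).

Let cnt : p <= 1 + adm (q, 1) + adm (r, 1) + adm (s, 1) + adm (q * r, 1) + adm (q * s, 1)
  + adm (r * s, 1) + adm (q * r * s, 1) + adm (r, q) + adm (s, q) + adm (s, r)
  + adm (q * r, s) + adm (s, q * r) + adm (q * s, r) + adm (r * s, q).
Proof.
have := simple_count pq pr ps pp qr rs npq npr nps G.
by rewrite /=  addn0 !addnA.
Qed.

(** The two ratios are mutually inverse and admissible ones are at least 1, so both together would
    give s = qr. *)
Let excl : adm (q * r, s) + adm (s, q * r) <= 1.
Proof.
case A: (adm (q * r, s)); case B: (adm (s, q * r)) => //.
have := admissible_le p1 A; have := admissible_le p1 B.
by move: (prime_neq_mul r pq ps (ltn_trans qr rs)); clear; lia.
Qed.

Let bound x y : adm (x, y) -> y <= x <= p.-1 * y := @admissible_le p x y p1.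

Lemma rs_ge15 : 15 <= r * s.
Proof.
have r3 : 2 < r := leq_ltn_trans q1 qr.
by apply: leq_trans (leq_mul r3 s5).
Qed.

Lemma qrs_ge30 : 30 <= q * r * s.
Proof. by rewrite -mulnA; apply: leq_trans (leq_mul q1 rs_ge15). Qed.

(** At most 14 of the 15 ratios are admissible together; for p = 13 or 14 the ratios rs and qrs
    exceed p - 1, which leaves 12. *)
Lemma simple_prime_le12 : p <= 12.
Proof.
rewrite leqNgt; apply/negP => p12.
have rs15 := rs_ge15; have qrs30 := qrs_ge30.
have p14 : p <= 14 by move: cnt excl; indicator_lia.
 have rs0 : adm (r * s, 1) = false by apply: (inadmissible p1); clear -p14 rs15; lia.
have qrs0 : adm (q * r * s, 1) = false by apply: (inadmissible p1); clear -p14 qrs30; lia.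
by move: cnt excl p12; rewrite rs0 qrs0; indicator_lia.
Qed.

(** For p = 2 only the ratio 1 is admissible. *)
Lemma simple_prime2 : p != 2.
Proof.
apply/eqP => p2.
have E x y : 0 < y -> x != y -> adm (x, y) = false.
  by rewrite p2 /admissible /= => y0 xy; move: xy y0; clear; lia.
have rs15 := rs_ge15; have qrs30 := qrs_ge30.
have rs' : q < r * s by rewrite (leq_trans qr) // leq_pmulr // prime_gt0.
have qs' : r < q * s by rewrite (leq_trans rs) // leq_pmull // prime_gt0.
have qs1 : 1 < q * s by apply: ltn_trans (prime_gt1 pr) qs'.
have qr'' : q * r != s by rewrite eq_sym (prime_neq_mul r pq ps (ltn_trans qr rs)).
have qr1 : 1 < q * r by rewrite (leq_trans q1) // leq_pmulr // prime_gt0.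
move: cnt; rewrite !E; clear -p2 q1 qr rs s5 rs' qs' qs1 qr'' qr1 rs15 qrs30; lia.
Qed.

(** Counting bounds all three primes if q >= 5 or r <= 4q, and the sweep applies; otherwise the
    infinite family arises. *)
Lemma simple_prime5 : p != 5.
Proof.
apply/eqP => p5; have bad x y : (x < y) || (4 * y < x) -> adm (x, y) = false.
  by move=> H; apply: (inadmissible p1); rewrite p5.
have ok x y : adm (x, y) -> (y <= x) && (x <= 4 * y) by move/bound; rewrite p5.
have rs15 := rs_ge15; have qrs30 := qrs_ge30.
have qr6 : 2 * 3 <= q * r by apply: leq_mul; last exact: leq_ltn_trans q1 qr.
have qs10 : 2 * 5 <= q * s by apply: leq_mul.
have rs5q : 4 * q < r * s by rewrite mulnC ltn_mul.
have s0 : adm (s, 1) = false by apply: bad; clear -s5; lia.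
have qr0 : adm (q * r, 1) = false by apply: bad; clear -qr6; lia.
have qs0 : adm (q * s, 1) = false by apply: bad; clear -qs10; lia.
have rs0 : adm (r * s, 1) = false by apply: bad; clear -rs15; lia.
have qrs0 : adm (q * r * s, 1) = false by apply: bad; clear -qrs30; lia.
have rsq0 : adm (r * s, q) = false by apply: bad; clear -rs5q; lia.
have c := cnt; rewrite s0 qr0 qs0 rs0 qrs0 rsq0 {1}p5 /= in c.
have sweep : q < 17 -> r < 17 -> s < 145 -> False.
  move=> a b d; apply: (sweep_contra pq pr ps pp qr rs npq npr nps G a b d).
  by rewrite p5; apply: sweep5.
case: (leqP q 4) => q4; last first.
  have qsr : 4 * r < q * s by rewrite ltn_mul.
  have q0 : adm (q, 1) = false by apply: bad; clear -q4; lia.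
  have r0 : adm (r, 1) = false by apply: bad; clear -q4 qr; lia.
  have qsr0 : adm (q * s, r) = false by apply: bad; clear -qsr; lia.
  rewrite q0 r0 qsr0 in c.
  have sq : s <= 4 * q.
    rewrite leqNgt; apply/negP => sq; have sq0 : adm (s, q) = false by apply: bad; rewrite sq orbT.
    by move: c excl; rewrite sq0; indicator_lia.
  (* If r > 16, then qr > 4s because s <= 4q, and at most four ratios survive. *)
  have r16 : r <= 16.
    rewrite -(@leq_pmul2l q) ?prime_gt0 // leqNgt; apply/negP => r16.
    have qr_s0 : adm (q * r, s) = false by apply: bad; clear -r16 sq; lia.
    have s_qr0 : adm (s, q * r) = false by apply: bad; clear -r16 sq q1; lia.
    by move: c; rewrite qr_s0 s_qr0; indicator_lia.
  by apply: sweep; clear -r16 qr sq; lia.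
case: (leqP r (4 * q)) => r4q.
  have q3 : q <= 3 by have q4' : q != 4 by [apply: contraTneq pq => ->]; clear -q4 q4'; lia.
  have qr36 : q * r <= 3 * 12 by apply: leq_mul => //; clear -q3 r4q; lia.
  have rqr : r <= q * r by rewrite leq_pmull // prime_gt0.
  have sqs : s <= q * s by rewrite leq_pmull // prime_gt0.
  apply: sweep; try (by clear -q3 r4q; lia).
  (* As qr <= 36, any s above 4 * 36 = 144 makes every ratio involving s inadmissible. *)
  rewrite ltnNge; apply/negP => s145.
  have sq0 : adm (s, q) = false by apply: bad; clear -s145 q3; lia.
  have sr0 : adm (s, r) = false by apply: bad; clear -s145 q3 r4q; lia.
  have qr_s0 : adm (q * r, s) = false by apply: bad; clear -s145 qr36; lia.
  have s_qr0 : adm (s, q * r) = false by apply: bad; clear -s145 qr36; lia.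
  have qs_r0 : adm (q * s, r) = false by apply: bad; clear -s145 sqs q3 r4q; lia.
  by move: c; rewrite sq0 sr0 qr_s0 s_qr0 qs_r0; indicator_lia.
have r0 : adm (r, 1) = false by apply: bad; clear -r4q q1; lia.
have rq0 : adm (r, q) = false by apply: bad; clear -r4q; lia.
have sq0 : adm (s, q) = false by apply: bad; clear -r4q rs; lia.
rewrite r0 rq0 sq0 in c.
(* At most five ratios remain, so all must occur. If s >= qr, then qs <= 4r would force q = 2 and s
   = qr. *)
have [sr qs_r qr_s] : [/\ adm (s, r), adm (q * s, r) & ~~ adm (s, q * r)].
  have qs_r : adm (q * s, r) by move: c excl; case: (adm (q * s, r)) => //; indicator_lia.
  split=> //; first by move: c excl; case: (adm (s, r)) => //; indicator_lia.
  apply/negP => A; have := ok _ _ A; have := ok _ _ qs_r.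
  have : q * (q * r) <= q * s -> 4 * r <= q * (q * r).
    by rewrite mulnA => _; rewrite leq_mul2r (leq_mul q1 q1) orbT.
  move: (prime_neq_mul r pq ps (ltn_trans qr rs)) q1; clear; nia.
have sr5 : 5 * r <= 4 * s.
  by move: sr; rewrite p5 /admissible /= => /orP[/eqP|/andP[]//]; clear -rs; lia.
apply: (five_ratios_contra pq pr ps pp qr rs npq npr nps G).
- by rewrite p5.
- by rewrite p5; clear -r4q sr5; lia.
suff /allP H : all (fun x => adm x ==> (x \in five_ratios q r s)) (ratios q r s).
  by move=> x /H /implyP.
rewrite /all /ratios s0 qr0 qs0 rs0 qrs0 rsq0 r0 rq0 sq0 (negbTE qr_s).
by rewrite !inE !eqxx !orbT !implybT.
Qed.

(** If r <= 5, then qr <= 15 and counting gives s <= 6 * 15. If r >= 7, at most seven ratios can be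
    admissible together, so q and s/q must be among them; thus q <= 5 and s <= 30. *)
Lemma simple_prime7 : p != 7.
Proof.
apply/eqP => p7; have bad x y : (x < y) || (6 * y < x) -> adm (x, y) = false.
  by move=> H; apply: (inadmissible p1); rewrite p7.
have rs15 := rs_ge15; have qrs30 := qrs_ge30.
have qs10 : 2 * 5 <= q * s by apply: leq_mul.
have qs0 : adm (q * s, 1) = false by apply: bad; clear -qs10; lia.
have rs0 : adm (r * s, 1) = false by apply: bad; clear -rs15; lia.
have qrs0 : adm (q * r * s, 1) = false by apply: bad; clear -qrs30; lia.
have c := cnt; rewrite qs0 rs0 qrs0 {1}p7 /= in c.
have sweep : q < 6 -> r < 31 -> s < 91 -> False.
  move=> a b d; apply: (sweep_contra pq pr ps pp qr rs npq npr nps G a b d).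
  by rewrite p7; apply: sweep7.
case: (leqP r 6) => r6.
  have r5 : r <= 5 by have r6' : r != 6 by [apply: contraTneq pr => ->]; clear -r6 r6'; lia.
  have q3 : q <= 3 by have q4' : q != 4 by [apply: contraTneq pq => ->]; clear -qr r5 q4'; lia.
  have qr15 : q * r <= 3 * 5 by apply: leq_mul.
  have sqs : s <= q * s by rewrite leq_pmull // prime_gt0.
  have srs : s <= r * s by rewrite leq_pmull // prime_gt0.
  apply: sweep; try (by clear -q3 r5; lia).
  rewrite ltnNge; apply/negP => s91.
  have s0 : adm (s, 1) = false by apply: bad; clear -s91; lia.
  have sq0 : adm (s, q) = false by apply: bad; clear -s91 q3; lia.
  have sr0 : adm (s, r) = false by apply: bad; clear -s91 r5; lia.
  have qr_s0 : adm (q * r, s) = false by apply: bad; clear -s91 qr15; lia.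
  have s_qr0 : adm (s, q * r) = false by apply: bad; clear -s91 qr15; lia.
  have qs_r0 : adm (q * s, r) = false by apply: bad; clear -s91 sqs r5; lia.
  have rs_q0 : adm (r * s, q) = false by apply: bad; clear -s91 srs q3; lia.
  by move: c; rewrite s0 sq0 sr0 qr_s0 s_qr0 qs_r0 rs_q0; indicator_lia.
have qr12 : 2 * 7 <= q * r by apply: leq_mul.
have r0 : adm (r, 1) = false by apply: bad; clear -r6; lia.
have s0 : adm (s, 1) = false by apply: bad; clear -r6 rs; lia.
have qr0 : adm (q * r, 1) = false by apply: bad; clear -qr12; lia.
have rsq0 : adm (r * s, q) = false.
  by apply: bad; apply/orP; right; rewrite mulnC ltn_mul // ltnW // (leq_ltn_trans r6).
rewrite r0 s0 qr0 rsq0 in c.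
have q6 : q != 6 by apply: contraTneq pq => ->.
have q5 : q <= 6.
  rewrite leqNgt; apply/negP => q7; have q0 : adm (q, 1) = false by apply: bad; clear -q7; lia.
  by move: c excl; rewrite q0; indicator_lia.
have sq : s <= 6 * q.
  rewrite leqNgt; apply/negP => sq; have sq0 : adm (s, q) = false by apply: bad; rewrite sq orbT.
  by move: c excl; rewrite sq0; indicator_lia.
by apply: sweep; clear -q6 q5 sq rs; lia.
Qed.

(** Without rs and qrs at most 12 ratios remain, and s >= 11 would remove both s and qs. *)
Lemma simple_prime11 : p != 11.
Proof.
apply/eqP => p11; have bad x y : (x < y) || (10 * y < x) -> adm (x, y) = false.
  by move=> H; apply: (inadmissible p1); rewrite p11.
have rs15 := rs_ge15; have qrs30 := qrs_ge30.
have rs0 : adm (r * s, 1) = false by apply: bad; clear -rs15; lia.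
have qrs0 : adm (q * r * s, 1) = false by apply: bad; clear -qrs30; lia.
have c := cnt; rewrite rs0 qrs0 {1}p11 /= in c.
have s10 : s < 11.
  rewrite ltnNge; apply/negP => s11; have sqs : s <= q * s by rewrite leq_pmull // prime_gt0.
  have s0 : adm (s, 1) = false by apply: bad; clear -s11; lia.
  have qs0 : adm (q * s, 1) = false by apply: bad; clear -s11 sqs; lia.
  by move: c excl; rewrite s0 qs0; indicator_lia.
have r10 := ltn_trans rs s10; have q10 := ltn_trans qr r10.
apply: (sweep_contra pq pr ps pp qr rs npq npr nps G q10 r10 s10).
by rewrite p11; apply: sweep11.
Qed.

End SimplePrimeFalse.

Lemma simple_prime_no_grid q r s p (w h : 'I_p -> nat) row col :
  prime q -> prime r -> prime s -> prime p -> q < r -> r < s ->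
  p != q -> p != r -> p != s -> ~ grid (p * (q * r * s)) w h row col.
Proof.
move=> pq pr ps pp qr rs npq npr nps G.
have := simple_prime_le12 pq pr ps pp qr rs npq npr nps G.
have := simple_prime2 pq pr ps pp qr rs npq npr nps G.
have := simple_prime5 pq pr ps pp qr rs npq npr nps G.
have := simple_prime7 pq pr ps pp qr rs npq npr nps G.
have := simple_prime11 pq pr ps pp qr rs npq npr nps G.
have p3 : p != 3 by apply/eqP => p3; subst p; apply: grid3_false G.
by case: p pp p3 {w h row col G npq npr nps}; do 13![case=> //].
Qed.

(** * The number of rectangles is the square of a prime *)

Section PrimeSquare.

Variables (q r s k : nat).
Hypotheses (pq : prime q) (pr : prime r) (ps : prime s) (qr : q < r) (rs : r < s).
Local Notation D := (q * r * s).
Variables (n : nat) (w h : 'I_k -> nat) (row col : 'I_k -> {set 'I_k}).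
Hypothesis G : grid n w h row col.
Hypothesis area : forall i, w i * h i = D ^ 2.

(** The area is now D^2, so the longer side is at least D and serves as the chosen side. *)
Lemma square_count (P : pred (nat * nat)) :
  (forall i x, 0 < x.1 -> 0 < x.2 -> maxn (w i) (h i) * x.2 = D * x.1 -> P x) ->
  k <= count P (ratios q r s).
Proof.
move=> HP; pose e i := maxn (w i) (h i).
have einj : injective e.
  apply: (grid_choose_side_inj G) => i; rewrite /e /maxn.
  by case: ifP => _; [right | left].
apply: (leq_count_sides (D := D) einj) => i.
have eD : e i %| D ^ 2.
  by rewrite -(area i) /e /maxn; case: ifP => _; [apply: dvdn_mull | apply: dvdn_mulr].
have De : D <= e i.
  rewrite -leq_sqr -(area i) -mulnn; apply: leq_mul; [apply: leq_maxl | apply: leq_maxr].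
have [x xin /and3P[x1 x2 /eqP ex]] := ratiosP pq pr ps (introT andP (conj qr rs)) eD De.
by exists x => //; rewrite (HP i x) // x2 ex eqxx.
Qed.

End PrimeSquare.

(** The longer side is D u with u between 1 and 3; at most seven ratios lie there, fewer than
    nine. *)
Lemma prime_square3_no_grid q r s (w h : 'I_9 -> nat) row col :
  prime q -> prime r -> prime s -> q < r -> r < s -> 3 != r ->
  ~ grid (3 * (q * r * s)) w h row col.
Proof.
move=> pq pr ps qr rs n3 G; have q1 := prime_gt1 pq; have s5 := third_prime_ge5 pq ps qr rs.
have D0 := D_gt0 pq pr ps; set D := q * r * s in G D0.
have area i : w i * h i = D ^ 2.
  by apply/eqP; rewrite -(@eqn_pmul2l 9) // (grid_area G) expnMn.
pose P (x : nat * nat) := x.2 <= x.1 <= 3 * x.2.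
have cnt : 9 <= count P (ratios q r s).
  apply: (square_count pq pr ps qr rs G area) => i x x1 x2 ex.
  have wn := grid_width_le G i; have hn := grid_width_le (grid_transpose G) i.
  have eD : maxn (w i) (h i) <= 3 * D by rewrite geq_max wn.
  have De : D <= maxn (w i) (h i).
    by rewrite -leq_sqr -(area i) -mulnn; apply: leq_mul; [apply: leq_maxl | apply: leq_maxr].
  rewrite /P; apply/andP; split; rewrite -(@leq_pmul2l D) // -ex.
    by rewrite leq_mul2r De orbT.
  by rewrite [D * _]mulnCA mulnA leq_mul2r eD orbT.
have bad x y : (x < y) || (3 * y < x) -> P (x, y) = false by rewrite /P /=; clear; lia.
have r4 : 4 <= r by clear -q1 qr n3; lia.
have qr8 : 2 * 4 <= q * r by apply: leq_mul.
have qs10 : 2 * 5 <= q * s by apply: leq_mul.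
have rs20 : 4 * 5 <= r * s by apply: leq_mul.
have qrs40 : 2 * (4 * 5) <= D by rewrite /D -mulnA; apply: leq_mul.
have rsq : 3 * q < r * s by rewrite mulnC ltn_mul // (leq_trans _ s5).
have r0 : P (r, 1) = false by apply: bad; clear -r4; lia.
have s0 : P (s, 1) = false by apply: bad; clear -s5; lia.
have qr0 : P (q * r, 1) = false by apply: bad; clear -qr8; lia.
have qs0 : P (q * s, 1) = false by apply: bad; clear -qs10; lia.
have rs0 : P (r * s, 1) = false by apply: bad; clear -rs20; lia.
have qrs0 : P (q * r * s, 1) = false by apply: bad; clear -qrs40; lia.
have rsq0 : P (r * s, q) = false by apply: bad; clear -rsq; lia.
have excl : P (q * r, s) + P (s, q * r) <= 1.
  by rewrite /P /=; move: (prime_neq_mul r pq ps (ltn_trans qr rs)); clear; lia.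
move: cnt excl; rewrite /ratios /count r0 s0 qr0 qs0 rs0 qrs0 rsq0.
move: P {r0 s0 qr0 qs0 rs0 qrs0 rsq0 bad} => P.
indicator_lia.
Qed.

Lemma odd_sum_odd (I : finType) (A : {set I}) (F : I -> nat) :
  (forall i, odd (F i)) -> odd (\sum_(i in A) F i) = odd #|A|.
Proof.
move=> oF; rewrite (eq_bigr (fun i => 1 + 2 * (F i)./2)) => [|i _].
  by rewrite big_split /= -big_distrr /= sum1_card oddD mul2n odd_double addbF.
by rewrite mul2n -{1}(odd_double_half (F i)) oF.
Qed.

(* All sides are odd and longer than D/2, so a row consists of exactly two rectangles. *)
Lemma prime_square2_width D (w h : 'I_4 -> nat) row col i :
  odd D -> grid (2 * D) w h row col -> (forall j, odd (w j)) ->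
  w i != D /\ 2 * w i < 3 * D.
Proof.
move=> oD G ow.
have wD j : D < 2 * w j.
  have : 2 * D <= 2 * (2 * w j) by rewrite mulnA; apply: (grid_width_ge G).
  rewrite leq_pmul2l // leq_eqVlt => /orP[/eqP E|//].
  by move: oD; rewrite E mul2n odd_double.
have sumr := grid_row G i.
have even : ~~ odd #|row i| by rewrite -(odd_sum_odd _ ow) sumr mul2n odd_double.
have lt4 : #|row i| * D.+1 <= 2 * (2 * D).
  by rewrite -sumr big_distrr /= -sum_nat_const; apply: leq_sum.
have c2 : #|row i| = 2.
  have : 0 < #|row i| by apply/card_gt0P; exists i; apply: (grid_rowi G).
  by case: #|row i| even lt4 => [|[|[|[|m]]]] //= _; nia.
have /cards1P [j Ej] : #|row i :\ i| == 1.
  by have := cardsD1 i (row i); rewrite (grid_rowi G) c2 => -[/eqP]; rewrite eq_sym.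
have ji : j != i by have := set11 j; rewrite -Ej !inE => /andP[].
have {sumr} sumr : w i + w j = 2 * D.
  by rewrite -sumr (big_setD1 i) ?(grid_rowi G) //= Ej big_set1.
have wj := wD j; split; last by lia.
apply/eqP => wi; have E : w j = w i by lia.
by rewrite (grid_inj G (or_introl E)) eqxx in ji.
Qed.

(** Since D is odd, all sides are odd, and the longer one is D u with 1 < u < 3/2. Besides r/q and
    s/r at most one of s/q, qr/s and s/(qr) lies there, giving three ratios for four rectangles. *)
Lemma prime_square2_no_grid q r s (w h : 'I_4 -> nat) row col :
  prime q -> prime r -> prime s -> 2 < q -> q < r -> r < s ->
  ~ grid (2 * (q * r * s)) w h row col.
Proof.
move=> pq pr ps q2 qr rs G; have D0 := D_gt0 pq pr ps; set D := q * r * s in G D0.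
have odd_p t : prime t -> 2 < t -> odd t by case/even_prime => [->|].
have r2 := ltn_trans q2 qr; have s2 := ltn_trans r2 rs.
have oD : odd D by rewrite !oddM !odd_p.
have area i : w i * h i = D ^ 2.
  by apply/eqP; rewrite -(@eqn_pmul2l 4) // (grid_area G) expnMn.
have [ow oh] : (forall i, odd (w i)) /\ (forall i, odd (h i)).
  have ox i : odd (w i) && odd (h i) by rewrite -oddM area oddX oD orbT.
  by split=> i; case/andP: (ox i).
have wP i := prime_square2_width i oD G ow.
have hP i := prime_square2_width i oD (grid_transpose G) oh.
pose P (x : nat * nat) := (x.2 < x.1) && (2 * x.1 < 3 * x.2).
have cnt : 4 <= count P (ratios q r s).
  apply: (square_count pq pr ps qr rs G area) => i x x1 x2 ex.
  have [wd w3] := wP i; have [hd h3] := hP i.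
  have eD : 2 * maxn (w i) (h i) < 3 * D by rewrite /maxn; case: ifP.
  have De : D < maxn (w i) (h i).
    rewrite ltn_neqAle; apply/andP; split.
      by rewrite eq_sym /maxn; case: ifP.
    by rewrite -leq_sqr -(area i) -mulnn; apply: leq_mul; [apply: leq_maxl | apply: leq_maxr].
  rewrite /P; apply/andP; split; rewrite -(@ltn_pmul2l D) //.
    by rewrite -ex ltn_mul2r x2 De.
  by rewrite ![D * (_ * _)]mulnCA -ex mulnA [3 * _]mulnA ltn_mul2r x2.
have bad x y : (x <= y) || (3 * y <= 2 * x) -> P (x, y) = false by rewrite /P /=; clear; lia.
have qr9 : 3 * 3 <= q * r by apply: leq_mul.
have qs9 : 3 * 3 <= q * s by apply: leq_mul.
have rs9 : 3 * 3 <= r * s by apply: leq_mul.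
have qrs27 : 3 * (3 * 3) <= D by rewrite /D -mulnA; apply: leq_mul.
have rsq : 3 * q <= r * s by rewrite mulnC; apply: leq_mul => //; apply: ltnW.
have qsr : 3 * r <= q * s by apply: leq_mul => //; apply: ltnW.
have c1 : P (1, 1) = false by apply: bad.
have q0 : P (q, 1) = false by apply: bad; clear -q2; lia.
have r0 : P (r, 1) = false by apply: bad; clear -r2; lia.
have s0 : P (s, 1) = false by apply: bad; clear -s2; lia.
have qr0 : P (q * r, 1) = false by apply: bad; clear -qr9; lia.
have qs0 : P (q * s, 1) = false by apply: bad; clear -qs9; lia.
have rs0 : P (r * s, 1) = false by apply: bad; clear -rs9; lia.
have qrs0 : P (q * r * s, 1) = false by apply: bad; clear -qrs27; lia.
have rsq0 : P (r * s, q) = false by apply: bad; clear -rsq; lia.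
have qsr0 : P (q * s, r) = false by apply: bad; clear -qsr; lia.
have excl : P (s, q) + (P (q * r, s) + P (s, q * r)) <= 1.
  have qr4 : q * 4 <= q * r by rewrite leq_mul2l (leq_ltn_trans q2 qr) orbT.
  by rewrite /P /=; clear -qr4 q2 rs; lia.
move: cnt excl; rewrite /ratios /count c1 q0 r0 s0 qr0 qs0 rs0 qrs0 rsq0 qsr0.
move: P {c1 q0 r0 s0 qr0 qs0 rs0 qrs0 rsq0 qsr0 bad} => P.
indicator_lia.
Qed.

(** * The number of rectangles is a product of two primes *)

Definition pair_ratios (a b q r : nat) : seq (nat * nat) :=
  [:: (1, 1); (a, 1); (q, 1); (r, 1); (q * r, 1); (r, q);
      (a * q, 1); (a * r, 1); (a * q * r, 1); (a * r, q);
      (b * q, 1); (b * r, 1); (b * q * r, 1); (b * r, q);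
      (a * b * q, 1); (a * b * r, 1); (a * b * q * r, 1); (a * b * r, q)].

Section PrimePair.

Variables (a b q r : nat).
Hypotheses (pa : prime a) (pb : prime b) (pq : prime q) (pr : prime r).
Local Notation D := (q * r).
Local Notation side i j c d := (a ^ i * (b ^ j * (q ^ c * r ^ d))).

(** The 36 divisors of the area form 18 complementary pairs of sides. The last hypothesis picks one
    of each pair by exponents instead of by size: first that of r, then q, then b. *)
Lemma pair_ratio_upper i j c d : i <= 1 -> j <= 1 -> c <= 2 -> d <= 2 ->
  [|| d == 2, (d == 1) && (c == 2) | [&& d == 1, c == 1 & j == 0]] ->
  exists2 x, x \in pair_ratios a b q r &
    [/\ 0 < x.1, 0 < x.2 & side i j c d * x.2 = D * x.1].
Proof.
have [a0 b0 q0 r0] : [/\ 0 < a, 0 < b, 0 < q & 0 < r] by rewrite !prime_gt0.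
move=> i1 j1 c2 d2 up.
exists (a ^ i * b ^ j * (if c == 2 then q else 1) * (if d == 2 then r else 1),
        if c == 0 then q else 1); last first.
  split=> /=.
  - by rewrite !muln_gt0 !expn_gt0 a0 b0 /=; do 2 case: ifP => _; rewrite ?q0 ?r0.
  - by case: ifP.
  by move: i1 j1 c2 d2 up => _ _; case: c => [|[|[|]]] //= _; case: d => [|[|[|]]] //= _ _; lia.
move: i1 j1 c2 d2 up; case: i => [|[|]] //= _; case: j => [|[|]] //= _;
  case: c => [|[|[|]]] //= _; case: d => [|[|[|]]] //= _ _;
  by rewrite ?expn0 ?expn1 ?mul1n ?muln1 !inE eqxx ?orbT.
Qed.

Lemma side_complement i j c d : i <= 1 -> j <= 1 -> c <= 2 -> d <= 2 ->
  side i j c d * side (1 - i) (1 - j) (2 - c) (2 - d) = a * b * D ^ 2.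
Proof.
move=> i1 j1 c2 d2.
have E t e m : e <= m -> t ^ e * t ^ (m - e) = t ^ m by move=> em; rewrite -expnD subnKC.
transitivity (a ^ i * a ^ (1 - i) * (b ^ j * b ^ (1 - j)) *
  (q ^ c * q ^ (2 - c) * (r ^ d * r ^ (2 - d)))); first by clear; lia.
by rewrite !E // !expn1 expnMn.
Qed.

Variables (w h : 'I_(a * b) -> nat) (row col : 'I_(a * b) -> {set 'I_(a * b)}).
Hypothesis G : grid (a * b * D) w h row col.

Lemma pair_ratio i : exists2 x, x \in pair_ratios a b q r &
  [/\ 0 < x.1, 0 < x.2 & w i * x.2 = D * x.1 \/ h i * x.2 = D * x.1].
Proof.
have ab0 : 0 < a * b by rewrite muln_gt0 !prime_gt0.
have A : w i * h i = a * b * D ^ 2.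
  by apply/eqP; rewrite -(@eqn_pmul2l (a * b)) // (grid_area G) expnMn mulnA mulnn.
have w0 := grid_w G i.
have wd : w i %| a ^ 1 * (b ^ 1 * (q ^ 2 * r ^ 2)).
  by rewrite !expn1 -expnMn mulnA -A dvdn_mulr.
have [ea [d1 [ea1 dd1 E1]]] := dvdn_pfactor_mul pa w0 wd.
have d10 : 0 < d1 by move: w0; rewrite E1 muln_gt0 => /andP[].
have [eb [d2 [eb1 dd2 E2]]] := dvdn_pfactor_mul pb d10 dd1.
have d20 : 0 < d2 by move: d10; rewrite E2 muln_gt0 => /andP[].
have [ec [d3 [ec2 dd3 E3]]] := dvdn_pfactor_mul pq d20 dd2.
have [ed ed2 E4] := dvdn_pfactor _ _ pr dd3.
have Ew : w i = side ea eb ec ed by rewrite E1 E2 E3 E4.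
have Eh : h i = side (1 - ea) (1 - eb) (2 - ec) (2 - ed).
  by apply/eqP; rewrite -(eqn_pmul2l w0) A Ew side_complement.
case up: [|| ed == 2, (ed == 1) && (ec == 2) | [&& ed == 1, ec == 1 & eb == 0]].
  have [x xin [x1 x2 ex]] := pair_ratio_upper ea1 eb1 ec2 ed2 up.
  by exists x => //; split=> //; left; rewrite Ew.
have up' : [|| 2 - ed == 2, (2 - ed == 1) && (2 - ec == 2) |
              [&& 2 - ed == 1, 2 - ec == 1 & 1 - eb == 0]].
  by move: up eb1 ec2 ed2; clear; case: eb => [|[|]]; case: ec => [|[|[|]]]; case: ed => [|[|[|]]].
have [x xin [x1 x2 ex]] := pair_ratio_upper (leq_subr ea 1) (leq_subr eb 1) (leq_subr ec 2)
  (leq_subr ed 2) up'.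
by exists x => //; split=> //; right; rewrite Eh.
Qed.

Lemma pair_ratio_le i x : 0 < x.2 ->
  w i * x.2 = D * x.1 \/ h i * x.2 = D * x.1 -> x.1 <= a * b * x.2.
Proof.
have D0 : 0 < D by rewrite muln_gt0 !prime_gt0.
have wn := grid_width_le G i; have hn := grid_width_le (grid_transpose G) i.
by move=> x2 [] E; rewrite -(leq_pmul2l D0) -E mulnCA mulnA leq_mul2r ?wn ?hn orbT.
Qed.

Lemma pair_count : a * b <= count (fun x => x.1 <= a * b * x.2) (pair_ratios a b q r).
Proof.
(* Both sides may be ratios of the list numerically; the width is then preferred. *)
pose e i := if has (fun x => (0 < x.2) && (w i * x.2 == D * x.1)) (pair_ratios a b q r)
  then w i else h i.
apply: (@leq_count_sides _ e D).
  by apply: (grid_choose_side_inj G) => i; rewrite /e; case: ifP; [left | right].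
move=> i; rewrite /e; case: ifP => [/hasP[x xin /andP[x2 /eqP ex]]|/hasPn none].
  by exists x => //; rewrite (pair_ratio_le (i := i)) ?x2 ?ex ?eqxx //; left.
have [x xin [x1 x2 [ex|ex]]] := pair_ratio i.
  by have := none x xin; rewrite x2 ex eqxx.
by exists x => //; rewrite (pair_ratio_le (i := i)) ?x2 ?ex ?eqxx //; right.
Qed.

Lemma pair_excluded_contra :
  excluded (N.of_nat D) (N.of_nat (a * b))
    (map toN [seq x <- pair_ratios a b q r | x.1 <= a * b * x.2]) -> False.
Proof.
apply: (excluded_no_grid G) => i; have [x xin [x1 x2 ex]] := pair_ratio i.
by exists x; rewrite // mem_filter (pair_ratio_le x2 ex).
Qed.

End PrimePair.

(** Here n = 210 and k = 6, the only pair case that counting does not settle. *)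
Lemma excluded210 : excluded (N.of_nat (5 * 7)) (N.of_nat (2 * 3))
  (map toN [seq x <- pair_ratios 2 3 5 7 | x.1 <= 2 * 3 * x.2]).
Proof. by vm_cast_no_check (erefl true). Qed.

(** The ratios not exceeding ab number at most 8, 13 and 14 for ab = 10, 14 and 15. *)
Lemma prime_pair_no_grid a b q r (w h : 'I_(a * b) -> nat) row col :
  prime a -> prime b -> prime q -> prime r -> a < b -> q < r ->
  a != q -> a != r -> b != q -> b != r -> a * b <= 18 ->
  ~ grid (a * b * (q * r)) w h row col.
Proof.
move=> pa pb pq pr ab qr aq ar bq br k18 G.
have cnt := pair_count pa pb pq pr G.
have contra := pair_excluded_contra pa pb pq pr G.
have [a1 q1] := (prime_gt1 pa, prime_gt1 pq).
have [q0 r0] : 0 < q /\ 0 < r by rewrite !prime_gt0.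
have np t m : prime t -> ~~ prime m -> t != m by move=> pt; apply: contraNneq => <-.
have {G} : [|| (a == 2) && (b == 3), (a == 2) && (b == 5), (a == 2) && (b == 7) |
               (a == 3) && (b == 5)].
  have a4 : a <= 3 by clear -ab a1 k18; nia.
  have b9 : b <= 9 by clear -ab a1 k18; nia.
  have [b4 [b6 [b8 b9']]] : b != 4 /\ b != 6 /\ b != 8 /\ b != 9 by rewrite !np.
  by clear -ab a1 a4 b9 b4 b6 b8 b9' k18; lia.
set P := (fun x => _) in cnt; have Pbad k x y : a * b = k -> k * y < x -> P (x, y) = false.
  by move=> <-; rewrite ltnNge /P => /negbTE.
case/or4P => /andP[/eqP Ea /eqP Eb]; subst a b.
- have [q4 q6] : q != 4 /\ q != 6 by rewrite !np.
  have [r6 [r8 [r9 r10]]] : r != 6 /\ r != 8 /\ r != 9 /\ r != 10 by rewrite !np.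
  have q5 : 5 <= q by clear -q1 aq bq q4; lia.
  have r7 : 7 <= r by clear -q5 qr r6; lia.
  have bad x y : 6 * y < x -> P (x, y) = false by apply: Pbad.
  have qr35 : 5 * 7 <= q * r by apply: leq_mul.
  (* Only 1, 2, q, r/q, 2r/q and 3r/q can be at most 6, so all six must be; hence q <= 6 and r <=
     2q. *)
  have c : P (q, 1) && P (3 * r, q).
    move: cnt; rewrite /count /pair_ratios (bad r 1) ?(bad (q * r) 1) ?(bad (2 * q) 1)
      ?(bad (2 * r) 1) ?(bad (2 * q * r) 1) ?(bad (3 * q) 1) ?(bad (3 * r) 1)
      ?(bad (3 * q * r) 1) ?(bad (2 * 3 * q) 1) ?(bad (2 * 3 * r) 1) ?(bad (2 * 3 * q * r) 1)
      ?(bad (2 * 3 * r) q); clear -q5 r7 qr35 qr; lia.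
  have [Eq Er] : q = 5 /\ r = 7.
    by move: c; rewrite /P /=; clear -q5 q6 r7 r8 r9 r10; lia.
  by subst q r; apply: contra; apply: excluded210.
- have [q4 [r4 r6]] : q != 4 /\ r != 4 /\ r != 6 by rewrite !np.
  have r7 : 7 <= r by clear -q1 qr aq br r4 r6 ; lia.
  have bad x y : 10 * y < x -> P (x, y) = false by apply: Pbad.
  have qr21 : 3 * 7 <= q * r by apply: leq_mul => //; clear -q1 aq; lia.
  move: cnt; rewrite /count /pair_ratios (bad (q * r) 1)
      ?(bad (2 * r) 1) ?(bad (2 * q * r) 1) ?(bad (5 * q) 1) ?(bad (5 * r) 1)
      ?(bad (5 * q * r) 1) ?(bad (2 * 5 * q) 1) ?(bad (2 * 5 * r) 1) ?(bad (2 * 5 * q * r) 1)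
      ?(bad (2 * 5 * r) q);
    [> by indicator_lia | by clear -q1 r7 qr21 qr aq; lia ..].
- have bad x y : 14 * y < x -> P (x, y) = false by apply: Pbad.
  have qr12 : 3 * 4 <= q * r by apply: leq_mul; clear -q1 aq qr; lia.
  move: cnt; rewrite /count /pair_ratios (bad (7 * q * r) 1) ?(bad (2 * 7 * q) 1)
    ?(bad (2 * 7 * r) 1) ?(bad (2 * 7 * q * r) 1)
    ?(bad (2 * 7 * r) q);
    [> by indicator_lia | by clear -q1 qr12 qr; lia ..].
- have bad x y : 15 * y < x -> P (x, y) = false by apply: Pbad.
  have qr6 : 2 * 3 <= q * r by apply: leq_mul; clear -q1 qr; lia.
  move: cnt; rewrite /count /pair_ratios (bad (3 * 5 * q) 1) ?(bad (3 * 5 * r) 1)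
    ?(bad (3 * 5 * q * r) 1) ?(bad (3 * 5 * r) q);
    [> by indicator_lia | by clear -q1 qr6 qr; lia ..].
Qed.

(** * The possible numbers of rectangles *)

Lemma grid_leq_sides n k (w h : 'I_k -> nat) row col (S : seq nat) :
  grid n w h row col -> (forall i, w i \in S) -> (forall i, h i \in S) -> k + k <= (size S).+1.
Proof.
move=> G wS hS; have G' := grid_transpose G.
pose A := [pred i | w i == h i].
have A1 : #|A| <= 1.
  apply/card_le1_eqP => i j /eqP wi /eqP wj; apply/esym/(grid_inj G); left; apply/eqP.
  by rewrite -eqn_sqr -!mulnn {2}wi {2}wj (grid_area_eq G i j).
(* All widths, and the heights of the non-square rectangles, are pairwise distinct; equal areas
   allow at most one square. *)
pose T := codom w ++ [seq h i | i in [predC A]].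
have uT : uniq T.
  have uw : uniq (codom w).
    by rewrite map_inj_uniq ?enum_uniq // => i j E; apply: (grid_inj G); left.
  have uh : uniq [seq h i | i in [predC A]].
    by rewrite map_inj_uniq ?enum_uniq // => i j E; apply: (grid_inj G'); left.
  rewrite cat_uniq uw uh andbT /=.
  apply/hasPn => z /imageP[i iA ->]; apply/negP => /codomP[j E].
  have ij : i = j by apply: (grid_inj G'); right.
  by move: iA; rewrite !inE E ij eqxx.
have TS : {subset T <= S}.
  by move=> z; rewrite mem_cat => /orP[/codomP[i ->]|/imageP[i _ ->]].
have := uniq_leq_size uT TS; rewrite size_cat size_codom size_image card_ord.
move: A1 (cardC A); rewrite card_ord.
by move: #|A| #|[predC A]| (size S) => u v z; clear; lia.
Qed.

Section FourPrimes.

Variables (a b c d : nat).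
Hypotheses (pa : prime a) (pb : prime b) (pc : prime c) (pd : prime d).
Hypotheses (ab : a < b) (bc : b < c) (cd : c < d).
Local Notation mono i j l m := (a ^ i * (b ^ j * (c ^ l * d ^ m))).

Lemma dvdn_mono x e1 e2 e3 e4 : 0 < x -> x %| mono e1 e2 e3 e4 ->
  exists i j l m, [/\ i <= e1, j <= e2, l <= e3, m <= e4 & x = mono i j l m].
Proof.
move=> x0 /(dvdn_pfactor_mul pa x0)[i [y [ie yd Ey]]].
have y0 : 0 < y by move: x0; rewrite Ey muln_gt0 => /andP[].
have [j [z [je zd Ez]]] := dvdn_pfactor_mul pb y0 yd.
have z0 : 0 < z by move: y0; rewrite Ez muln_gt0 => /andP[].
have [l [t [le td Et]]] := dvdn_pfactor_mul pc z0 zd.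
have [m me Em] := dvdn_pfactor _ _ pd td.
by exists i, j, l, m; split=> //; rewrite Ey Ez Et Em.
Qed.

Let powers p e := [seq p ^ i | i <- iota 0 e.+1].
Definition mono_divisors e1 e2 e3 e4 :=
  allpairs muln (powers a e1) (allpairs muln (powers b e2) (allpairs muln (powers c e3) (powers d e4))).

Lemma size_mono_divisors e1 e2 e3 e4 :
  size (mono_divisors e1 e2 e3 e4) = e1.+1 * (e2.+1 * (e3.+1 * e4.+1)).
Proof. by rewrite /mono_divisors !size_allpairs !size_map !size_iota. Qed.

Lemma mem_mono_divisors x e1 e2 e3 e4 : 0 < x -> x %| mono e1 e2 e3 e4 ->
  x \in mono_divisors e1 e2 e3 e4.
Proof.
move=> x0 /(dvdn_mono x0)[i [j [l [m [ie je le me ->]]]]].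
have pw p e t : t <= e -> p ^ t \in powers p e by move=> te; rewrite map_f // mem_iota.
by do 3![apply: allpairs_f; first exact: pw]; apply: pw.
Qed.

Lemma four_primes_ge : [/\ 2 <= a, 3 <= b, 5 <= c & 7 <= d].
Proof.
have np t m : prime t -> ~~ prime m -> t != m by move=> pt; apply: contraNneq => <-.
have a2 := prime_gt1 pa.
have [c4 [d6 d4]] : c != 4 /\ d != 6 /\ d != 4 by rewrite !np.
by clear -a2 ab bc cd c4 d6 d4; split; lia.
Qed.

Variables (k : nat) (w h : 'I_k -> nat) (row col : 'I_k -> {set 'I_k}).
Hypothesis G : grid (a * (b * (c * d))) w h row col.

(** [k] divides n^2, and all sides are divisors of n^2 / k, whose number is the product on the
    right. *)
Lemma index_exponents : exists i j l m,
  [/\ [&& i <= 2, j <= 2, l <= 2 & m <= 2], k = mono i j l m &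
   k + k <= ((3 - i) * ((3 - j) * ((3 - l) * (3 - m)))).+1].
Proof.
have k0 := ltnW (grid_k G).
have sq : (a * (b * (c * d))) ^ 2 = mono 2 2 2 2 by rewrite !expnMn.
pose o := Ordinal k0.
have kd : k %| mono 2 2 2 2 by rewrite -sq -(grid_area G o) dvdn_mulr.
have [i [j [l [m [i2 j2 l2 m2 Ek]]]]] := dvdn_mono k0 kd.
exists i, j, l, m; split=> //; first by rewrite i2 j2 l2 m2.
have area t : w t * h t = mono (2 - i) (2 - j) (2 - l) (2 - m).
  apply/eqP; rewrite -(eqn_pmul2l k0) (grid_area G) sq {1}Ek; apply/eqP.
  have E p e : e <= 2 -> p ^ 2 = p ^ e * p ^ (2 - e) by move=> e2; rewrite -expnD subnKC.
  by rewrite (E a i) // (E b j) // (E c l) // (E d m) //; clear; lia.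
rewrite (subSn i2) (subSn j2) (subSn l2) (subSn m2) -size_mono_divisors.
apply: (grid_leq_sides G) => t; apply: mem_mono_divisors.
- exact: (grid_w G).
- by rewrite -(area t) dvdn_mulr.
- exact: (grid_h G).
- by rewrite -(area t) dvdn_mull.
Qed.

(* The number of rectangles is at most half the number of divisors of their
   area; this leaves k = p, k = p ^ 2 or k = p p' with small primes p, p'. *)
Lemma four_primes_no_grid : False.
Proof.
have [a2 b3 c5 d7] := four_primes_ge.
have k1 := grid_k G.
have [i [j [l [m [/and4P[i2 j2 l2 m2] Ek bound]]]]] := index_exponents.
have ge x y e : x <= y -> x ^ e <= y ^ e by case: e => // e; rewrite leq_exp2r.
have low : 2 ^ i * (3 ^ j * (5 ^ l * 7 ^ m)) <= k.
  by rewrite Ek; do 3![apply: leq_mul; first exact: ge]; apply: ge.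
have [ac [bd ad]] : a < c /\ b < d /\ a < d by clear -ab bc cd; lia.
have regroup N : N = a * (b * (c * d)) -> grid N w h row col by move=> ->.
have simple p q r s : prime p -> prime q -> prime r -> prime s -> q < r -> r < s ->
    p != q -> p != r -> p != s -> p * (q * r * s) = a * (b * (c * d)) -> k = p -> False.
  move=> pp pq pr ps qr rs npq npr nps /regroup G' kp; clear Ek; subst k.
  exact: simple_prime_no_grid pq pr ps pp qr rs npq npr nps G'.
(* The bounds 14 here and 18 below come from the 27 and 36 divisors of the area. *)
have square p q r s : prime q -> prime r -> prime s -> q < r -> r < s -> 1 < p ->
    p != q -> p != r -> p * (q * r * s) = a * (b * (c * d)) -> k = p * p -> p * p <= 14 -> False.
  move=> pq pr ps qr rs p1 npq npr /regroup G' kp p14.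
  have : p = 2 \/ p = 3 by clear -p1 p14; nia.
  clear Ek; case=> p23; subst p; subst k.
    have q2 : 2 < q by have := prime_gt1 pq; clear -npq; lia.
    exact: prime_square2_no_grid pq pr ps q2 qr rs G'.
  exact: prime_square3_no_grid pq pr ps qr rs npr G'.
have pair p p' q r : prime p -> prime p' -> prime q -> prime r -> p < p' -> q < r ->
    p != q -> p != r -> p' != q -> p' != r -> p * p' * (q * r) = a * (b * (c * d)) ->
    k = p * p' -> p * p' <= 18 -> False.
  move=> pp pp' pq pr lp lq n1 n2 n3 n4 /regroup G' kp le18; clear Ek; subst k.
  exact: prime_pair_no_grid pp pp' pq pr lp lq n1 n2 n3 n4 le18 G'.
have nab : a != b by rewrite ltn_eqF.
have nac : a != c by rewrite ltn_eqF.
have nad : a != d by rewrite ltn_eqF.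
have nbc : b != c by rewrite ltn_eqF.
have nbd : b != d by rewrite ltn_eqF.
have ncd : c != d by rewrite ltn_eqF.
have [nba [nca nda]] : b != a /\ c != a /\ d != a by rewrite !gtn_eqF.
have [ncb [ndb ndc]] : c != b /\ d != b /\ d != c by rewrite !gtn_eqF.
move: Ek bound low; clear -simple square pair k1 a2 pa pb pc pd ab bc cd ac bd ad nab nac nad
  nbc nbd ncd nba nca nda ncb ndb ndc i2 j2 l2 m2.
(* Of the 81 exponent vectors, [bound] and [low] leave ten. *)
case: i i2 => [|[|[|]]] // _; case: j j2 => [|[|[|]]] // _;
  case: l l2 => [|[|[|]]] // _; case: m m2 => [|[|[|]]] // _;
  rewrite ?expn0 ?expn1 ?mul1n ?muln1 -?mulnn => Ek bound low;
  try (by clear -Ek bound low k1; lia).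
- by apply: (simple d a b c) => //; clear; lia.
- by apply: (simple c a b d) => //; clear; lia.
- by apply: (simple b a c d) => //; clear; lia.
- by apply: (pair b c a d) => //; clear -Ek bound; lia.
- by apply: (square b a c d) => //; clear -Ek bound a2 ab; lia.
- by apply: (simple a b c d) => //; clear; lia.
- by apply: (pair a d b c) => //; clear -Ek bound; lia.
- by apply: (pair a c b d) => //; clear -Ek bound; lia.
- by apply: (pair a b c d) => //; clear -Ek bound; lia.
- by apply: (square a b c d) => //; clear -Ek bound; lia.
Qed.

End FourPrimes.

(** * Reduction to four primes and conclusion *)

Lemma prod_distinct_primes_extend m n : prod_distinct_primes m n ->
  exists2 p, 0 < p & prod_distinct_primes m.+1 (p * n).
Proof.
(* A prime above the product cannot be one of its factors. *)
case=> s [us ps <- ->]; have [p pn pp] := prime_above (\prod_(p <- s) p).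
exists p; first exact: prime_gt0.
exists (p :: s); rewrite /= big_cons pp us ps; split=> //; rewrite andbT.
apply/negP => pin; have : p %| \prod_(q <- s) q by rewrite (big_rem p) //= dvdn_mulr.
have n0 : 0 < \prod_(q <- s) q by rewrite big_seq prodn_cond_gt0 // => q /(allP ps)/prime_gt0.
by move/(dvdn_leq n0); rewrite leqNgt pn.
Qed.

Lemma prod_four_primes n : prod_distinct_primes 4 n ->
  exists a b c d, [/\ [&& prime a, prime b, prime c & prime d], [&& a < b, b < c & c < d] &
    n = a * (b * (c * d))].
Proof.
case=> s [us ps ss ->].
have : sorted ltn (sort leq s) by rewrite ltn_sorted_uniq_leq sort_uniq us sort_sorted //; exact: leq_total.
rewrite -(perm_big _ (introT permPl (perm_sort leq s))) /=.
have : all prime (sort leq s) by rewrite all_sort.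
have : size (sort leq s) = 4 by rewrite size_sort.
case: (sort leq s) => [|a [|b [|c [|d [|]]]]] //= _ /and5P[pa pb pc pd _] /and4P[ab bc cd _].
exists a, b, c, d; rewrite pa pb pc pd ab bc cd; split=> //.
by rewrite !big_cons big_nil muln1.
Qed.

Theorem mainTheorem9 (n : nat) :
  (prod_distinct_primes 2 n \/ prod_distinct_primes 3 n \/ prod_distinct_primes 4 n) ->
  ~ (exists (k : nat) (x y w h : 'I_k -> nat), perfect_mondrian_partition n k x y w h).
Proof.
move=> hn [k [x [y [w [h /grid_of_partition[row [col G]]]]]]].
have no4 m (w' h' : 'I_k -> nat) : prod_distinct_primes 4 m -> ~ grid m w' h' row col.
  case/prod_four_primes => [a [b [c [d [/and4P[pa pb pc pd] /and3P[ab bc cd] ->]]]]].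
  exact: four_primes_no_grid.
have no3 m (w' h' : 'I_k -> nat) : prod_distinct_primes 3 m -> ~ grid m w' h' row col.
  by case/prod_distinct_primes_extend => p p0 /no4 no /(grid_scale p0) /no.
case: hn => [h2|[/no3 no|/no4 no]]; [|exact: no G|exact: no G].
by case/prod_distinct_primes_extend: h2 => p p0 /no3 no; apply: no (grid_scale p0 G).
Qed.
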